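(* Consider the two-dimensional compressible Euler equations with periodic boundary conditions on a domain $\Omega$ with a conforming mesh of curved quadrilateral elements $\{\Omega_e\}_{e=1}^{N_e}$ whose nodal geometric derivatives satisfy the discrete metric identities on each element. Let $\{\bm U_N^e(t)\}_e$, $\bm U_N^e=(U_1^e,\dots,U_4^e)^T\in[\mathbb Q_N([-1,1]^2)]^4$, with nodal values differentiable in $t$ and positive density and pressure at all nodes, be a solution of the entropy-stable DGSEM (all objects as defined in the context): for every $e$, all $0\le p_1,p_2\le N$ and $k=1,\dots,4$, \[ \begin{aligned} &w_{p_1}w_{p_2}\Bigl(\mathcal J^e_{p_1,p_2}(\partial_tU_k^e)_{p_1,p_2}+2\sum_{i=0}^N D_{p_1,i}(\tilde f_k^{e,\#})_{(i,p_1),p_2}+2\sum_{j=0}^N D_{p_2,j}(\tilde g_k^{e,\#})_{p_1,(j,p_2)}\Bigr)\\ &+w_{p_1}\Bigl((\tilde g_k^e-\tilde g_k^{e,*})_{p_1,0}\delta_{p_2,0}-(\tilde g_k^e-\tilde g_k^{e,*})_{p_1,N}\delta_{p_2,N}\Bigr)+w_{p_2}\Bigl((\tilde f_k^e-\tilde f_k^{e,*})_{0,p_2}\delta_{p_1,0}-(\tilde f_k^e-\tilde f_k^{e,*})_{N,p_2}\delta_{p_1,N}\Bigr)=0 . \end{aligned} \] Assume that the numerical interface flux is entropy stable in the sense that, for the left and right traces $\bm U_L,\bm U_R$ of the numerical solution at the LGL nodes of every interface (periodic interfaces included), with unit normal $\bm n$ pointing from the left to the right element, \[ (\bm V_R-\bm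 V_L)\cdot\bigl(\bm F^*(\bm U_L,\bm U_R)\cdot\bm n\bigr)-(\bm\psi_R-\bm\psi_L)\cdot\bm n\le 0 . \] Then \[ \sum_{e=1}^{N_e}\sum_{p_1,p_2=0}^N w_{p_1}w_{p_2}\,\mathcal J^e_{p_1,p_2}\bigl(\partial_t S(\bm U_N^e)\bigr)_{p_1,p_2}\le 0 . \]
   Context: **Euler equations.** $\partial_t\bm U+\partial_x\bm f(\bm U)+\partial_y\bm g(\bm U)=0$, $\bm U=(\rho,\rho u,\rho v,E)^T$, $\bm f=(\rho u,\rho u^2+p,\rho uv,(E+p)u)^T$, $\bm g=(\rho v,\rho uv,\rho v^2+p,(E+p)v)^T$, with $E=\rho e+\tfrac12\rho(u^2+v^2)$, $p=(\gamma-1)\rho e$, $\gamma=1.4$. Admissible states have $\rho>0$, $p>0$. **Entropy.** $S(\bm U)=-\rho s/(\gamma-1)$ with $s=\log(p\rho^{-\gamma})$ (the letter $\eta$ is reserved here for a coordinate). Entropy variables: $\bm V=(V_1,\dots,V_4)^T$, $V_k=\partial S/\partial U_k$. Entropy potential fluxes: $\bm\psi=(\psi^f,\psi^g)=(\rho u,\rho v)$. Subscripts $L,R$ on $\bm V,\bm\psi$ mean evaluation at $\bm U_L,\bm U_R$. **Nodal DG.** $\{\xi_i\}_{i=0}^N$ are the $N+1$ Legendre–Gauss–Lobatto (LGL) points on $[-1,1]$ ($N\ge1$, $\xi_0=-1$, $\xi_N=1$; the same points $\eta_j=\xi_j$ are used in the $\eta$ direction), $w_i$ are the LGL quadrature weights,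 $\phi_j$ the Lagrange polynomials with $\phi_j(\xi_i)=\delta_{ij}$, and $D_{i,j}=\phi_j'(\xi_i)$. $\mathbb Q_N([-1,1]^2)=\mathrm{span}\{\phi_i(\xi)\phi_j(\eta):0\le i,j\le N\}$. A subscript $(\cdot)_{i,j}$ denotes the value at the node $(\xi_i,\eta_j)$; a superscript $e$ (sometimes omitted) denotes the element. **Geometry.** Each element has a smooth invertible mapping $(x^e(\xi,\eta),y^e(\xi,\eta))$ from $[-1,1]^2$ onto $\Omega_e$, with $\mathcal J^e=x^e_\xi y^e_\eta-x^e_\eta y^e_\xi>0$; nodal values of $x_\xi,x_\eta,y_\xi,y_\eta$ are used. The mesh is conforming and non-overlapping: every face of every element is shared with exactly one other element face (faces on the domain boundary being identified by periodicity, up to translation), and the two element mappings parametrize a shared face identically up to a possible reversal of direction, so that LGL nodes on the two sides coincide. The discrete metric identities on each element are: for all $0\le q_1,q_2\le N$, \[ \sum_{p=0}^N D_{q_2,p}(y_\xi)_{q_1,p}=\sum_{p=0}^N D_{q_1,p}(y_\eta)_{p,q_2},\qquad \sum_{p=0}^N D_{q_2,p}(x_\xi)_{q_1,p}=\sum_{p=0}^N D_{q_1,p}(x_\eta)_{p,q_2}. \] **Contravariant fluxes (at each node).** $\tilde f_k=y_\eta f_k(\bm U)-x_\eta g_k(\bm U)$, $\tilde g_k=-y_\xi f_k(\bm U)+x_\xi g_k(\bm U)$. **Two-point volume flux (Chandrashekar).** For two states $L,R$ let $\{\!\{a\}\!\}=\tfrac12(a_L+a_R)$, $a^{\log}=\frac{a_L-a_R}{\log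 a_L-\log a_R}$ (with $a^{\log}=a_L$ if $a_L=a_R$), $\beta=\rho/(2p)$, $\hat p=\frac{\{\!\{\rho\}\!\}}{2\{\!\{\beta\}\!\}}$, and \[ \hat h=\frac{1}{2\beta^{\log}(\gamma-1)}-\tfrac12\bigl(\{\!\{u^2\}\!\}+\{\!\{v^2\}\!\}\bigr)+\frac{\hat p}{\rho^{\log}}+\{\!\{u\}\!\}^2+\{\!\{v\}\!\}^2 . \] Then $\bm f^\#=(\rho^{\log}\{\!\{u\}\!\},\ \rho^{\log}\{\!\{u\}\!\}^2+\hat p,\ \rho^{\log}\{\!\{u\}\!\}\{\!\{v\}\!\},\ \rho^{\log}\{\!\{u\}\!\}\hat h)^T$ and $\bm g^\#=(\rho^{\log}\{\!\{v\}\!\},\ \rho^{\log}\{\!\{u\}\!\}\{\!\{v\}\!\},\ \rho^{\log}\{\!\{v\}\!\}^2+\hat p,\ \rho^{\log}\{\!\{v\}\!\}\hat h)^T$. The subscript $(i,p_1),p_2$ means the two states (or metric values) are those at nodes $(\xi_i,\eta_{p_2})$ and $(\xi_{p_1},\eta_{p_2})$; the subscript $p_1,(j,p_2)$ means those at $(\xi_{p_1},\eta_j)$ and $(\xi_{p_1},\eta_{p_2})$. The contravariant volume fluxes are \[ (\tilde f_k^\#)_{(i,p_1),p_2}=\{\!\{y_\eta\}\!\}_{(i,p_1),p_2}(f_k^\#)_{(i,p_1),p_2}-\{\!\{x_\eta\}\!\}_{(i,p_1),p_2}(g_k^\#)_{(i,p_1),p_2}, \] \[ (\tilde g_k^\#)_{p_1,(j,p_2)}=-\{\!\{y_\xi\}\!\}_{p_1,(j,p_2)}(f_k^\#)_{p_1,(j,p_2)}+\{\!\{x_\xi\}\!\}_{p_1,(j,p_2)}(g_k^\#)_{p_1,(j,p_2)}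 . \] **Numerical interface flux.** For a unit normal $\bm n$ pointing from the left to the right state, $\bm F^*(\bm U_L,\bm U_R)\cdot\bm n\in\mathbb R^4$ is the local Lax–Friedrichs flux with components \[ \bm F_k^*\cdot\bm n=\tfrac12\,\bm n\cdot\bigl(\bm F_k(\bm U_L)+\bm F_k(\bm U_R)\bigr)-\tfrac{\alpha}{2}\bigl((U_k)_R-(U_k)_L\bigr),\quad \alpha=\max\{|\bm u_L\cdot\bm n|+c_L,\ |\bm u_R\cdot\bm n|+c_R\}, \] with $\bm F_k=(f_k,g_k)$, $\bm u=(u,v)$, $c=\sqrt{\gamma p/\rho}$. In the scheme on $\Omega_e$, $\tilde f_k^{e,*}$ is needed only at nodes with $\xi=\pm1$ and $\tilde g_k^{e,*}$ only at nodes with $\eta=\pm1$: with $\bm n$ the outward unit normal of $\Omega_e$, $\bm U_L$ the nodal state of $\Omega_e$ and $\bm U_R$ that of the neighbouring element at the same node, $\tilde f_k^{e,*}=\pm|(y^e_\eta,-x^e_\eta)|\,\bm F_k^*\cdot\bm n$ on $\xi=\pm1$, and $\tilde g_k^{e,*}=\pm|(-y^e_\xi,x^e_\xi)|\,\bm F_k^*\cdot\bm n$ on $\eta=\pm1$. *)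

(* Defs.v *)
From HB Require Import structures.
From mathcomp Require Import all_boot all_order all_algebra.
From mathcomp Require Import all_classical all_reals all_analysis.

Set Implicit Arguments.
Unset Strict Implicit.
Unset Printing Implicit Defensive.

Import Order.TTheory GRing.Theory Num.Theory.
Import numFieldNormedType.Exports.

Local Open Scope classical_set_scope.
Local Open Scope ring_scope.

Section LGL.
Variables (R : realType) (N : nat).

(* Rodrigues' formula. *)
Definition legendre (n : nat) : {poly R} :=
  ((2 ^+ n * n`!%:R)^-1) *: (('X^2 - 1) ^+ n)^`(n).

(* The N + 1 zeros of (1 - x^2) P_N'(x), in increasing order. *)
Definition is_LGL (xi : 'I_N.+1 -> R) : Prop :=
  [/\ forall i j : 'I_N.+1, (i < j)%N -> xi i < xi j,
      xi ord0 = -1,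
      xi ord_max = 1 &
      forall i : 'I_N.+1, i != ord0 -> i != ord_max ->
        root (legendre N)^`() (xi i)].

Variable xi : 'I_N.+1 -> R.

Definition lagrange_poly (j : 'I_N.+1) : {poly R} :=
  \prod_(i < N.+1 | i != j) ((xi j - xi i)^-1 *: ('X - (xi i)%:P)).

Definition lgl_weight (i : 'I_N.+1) : R :=
  Rintegral (@lebesgue_measure R) `[-1, 1] (fun x => (lagrange_poly i).[x]).

Definition dmat (i j : 'I_N.+1) : R := (lagrange_poly j)^`().[xi i].

Definition node (i j : 'I_N.+1) : R * R := (xi i, xi j).

Definition ref_square : set (R * R) :=
  [set z | -1 <= z.1 <= 1 /\ -1 <= z.2 <= 1].

Definition open_ref_square : set (R * R) :=
  [set z | -1 < z.1 < 1 /\ -1 < z.2 < 1].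

(* The restriction of g to the reference square lies in Q_N([-1,1]^2). *)
Definition in_QN (g : R * R -> R) : Prop :=
  exists c : 'I_N.+1 -> 'I_N.+1 -> R, forall z, ref_square z ->
    g z = \sum_(i < N.+1) \sum_(j < N.+1)
            c i j * ((lagrange_poly i).[z.1] * (lagrange_poly j).[z.2]).

End LGL.

Section Euler.
Variable R : realType.
Implicit Types U UL UR : 'rV[R]_4.

Definition gamma : R := 7 / 5.

Definition vec4 (a b c d : R) : 'rV[R]_4 := \row_k [:: a; b; c; d]`_k.

Definition rho U : R := U 0 (@Ordinal 4 0 isT).
Definition velx U : R := U 0 (@Ordinal 4 1 isT) / rho U.
Definition vely U : R := U 0 (@Ordinal 4 2 isT) / rho U.
Definition energy U : R := U 0 (@Ordinal 4 3 isT).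

(* E = rho e + rho (u^2 + v^2) / 2 solved for p = (gamma - 1) rho e. *)
Definition pressure U : R :=
  (gamma - 1) * (energy U - rho U * (velx U ^+ 2 + vely U ^+ 2) / 2).

Definition admissible U : Prop := 0 < rho U /\ 0 < pressure U.

Definition flux_f U : 'rV[R]_4 :=
  vec4 (rho U * velx U)
       (rho U * velx U ^+ 2 + pressure U)
       (rho U * velx U * vely U)
       ((energy U + pressure U) * velx U).

Definition flux_g U : 'rV[R]_4 :=
  vec4 (rho U * vely U)
       (rho U * velx U * vely U)
       (rho U * vely U ^+ 2 + pressure U)
       ((energy U + pressure U) * vely U).

Definition entropy U : R :=
  - (rho U * ln (pressure U * rho U `^ (- gamma))) / (gamma - 1).

Definition entropy_var U : 'rV[R]_4 :=
  \row_k 'D_(delta_mx 0 k : 'rV[R]_4) entropy U.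

Definition psi_f U : R := rho U * velx U.
Definition psi_g U : R := rho U * vely U.

Definition avg (a b : R) : R := (a + b) / 2.
Definition logmean (a b : R) : R :=
  if a == b then a else (a - b) / (ln a - ln b).

Definition beta U : R := rho U / (2 * pressure U).

Definition phat UL UR : R :=
  avg (rho UL) (rho UR) / (2 * avg (beta UL) (beta UR)).

Definition hhat UL UR : R :=
  1 / (2 * logmean (beta UL) (beta UR) * (gamma - 1))
  - (avg (velx UL ^+ 2) (velx UR ^+ 2) + avg (vely UL ^+ 2) (vely UR ^+ 2)) / 2
  + phat UL UR / logmean (rho UL) (rho UR)
  + avg (velx UL) (velx UR) ^+ 2 + avg (vely UL) (vely UR) ^+ 2.

Definition fsharp UL UR : 'rV[R]_4 :=
  let rl := logmean (rho UL) (rho UR) in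
  let u := avg (velx UL) (velx UR) in
  let v := avg (vely UL) (vely UR) in
  vec4 (rl * u) (rl * u ^+ 2 + phat UL UR) (rl * u * v) (rl * u * hhat UL UR).

Definition gsharp UL UR : 'rV[R]_4 :=
  let rl := logmean (rho UL) (rho UR) in
  let u := avg (velx UL) (velx UR) in
  let v := avg (vely UL) (vely UR) in
  vec4 (rl * v) (rl * u * v) (rl * v ^+ 2 + phat UL UR) (rl * v * hhat UL UR).

Definition dot2 (a b : R * R) : R := a.1 * b.1 + a.2 * b.2.
Definition norm2 (a : R * R) : R := Num.sqrt (a.1 ^+ 2 + a.2 ^+ 2).

Definition sound_speed U : R := Num.sqrt (gamma * pressure U / rho U).

Definition lf_speed (n : R * R) UL UR : R :=
  Num.max (`|dot2 (velx UL, vely UL) n| + sound_speed UL)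
          (`|dot2 (velx UR, vely UR) n| + sound_speed UR).

(* F^*(UL, UR) . n *)
Definition lf_flux (n : R * R) UL UR : 'rV[R]_4 :=
  \row_k (dot2 n (flux_f UL 0 k + flux_f UR 0 k, flux_g UL 0 k + flux_g UR 0 k)
            / 2
          - lf_speed n UL UR / 2 * (UR 0 k - UL 0 k)).

Definition entropy_stable_at (n : R * R) UL UR : Prop :=
  \sum_(k < 4) (entropy_var UR 0 k - entropy_var UL 0 k) * lf_flux n UL UR 0 k
  - dot2 (psi_f UR - psi_f UL, psi_g UR - psi_g UL) n <= 0.

End Euler.

Section Mesh.
Variable R : realType.

Definition d_xi (g : R * R -> R) (z : R * R) : R :=
  'D_((1, 0) : R * R) g z.
Definition d_eta (g : R * R -> R) (z : R * R) : R :=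
  'D_((0, 1) : R * R) g z.

Fixpoint Ck_on (n : nat) (O : set (R * R)) (g : R * R -> R) : Prop :=
  (forall z, O z -> {for z, continuous g}) /\
  if n is m.+1 then
    [/\ forall z, O z -> derivable g z ((1, 0) : R * R),
        forall z, O z -> derivable g z ((0, 1) : R * R),
        Ck_on m O (d_xi g) & Ck_on m O (d_eta g)]
  else True.

(* Smoothness on the closed square is smoothness on some open neighbourhood;
   d_xi and d_eta are then the one-sided derivatives on the boundary. *)
Definition smooth_on_square (g : R * R -> R) : Prop :=
  exists O : set (R * R),
    [/\ open O, @ref_square R `<=` O & forall n, Ck_on n O g].

(* The face (false, b) is xi = -1 or 1, the face (true, b) is eta = -1 or 1;
   the sign is that of b (true for +). *)
Definition face : Type := (bool * bool)%type.

Definition face_sgn (f : face) : R := if f.2 then 1 else -1.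

Definition face_pt (f : face) (s : R) : R * R :=
  if f.1 then (s, face_sgn f) else (face_sgn f, s).

(* xmap e and ymap e are the components of the mapping of element e.
   The face nbr F is the one identified with F, the parameter being
   reversed when face_rev F, and the identification in the physical plane being the
   translation by face_shift F (zero for interior faces). *)
Record mesh (Ne : nat) := Mesh {
  xmap : 'I_Ne -> R * R -> R;
  ymap : 'I_Ne -> R * R -> R;
  nbr : 'I_Ne * face -> 'I_Ne * face;
  face_rev : 'I_Ne * face -> bool;
  face_shift : 'I_Ne * face -> R * R
}.

Variables (Ne : nat) (M : mesh Ne).

Definition emap (e : 'I_Ne) (z : R * R) : R * R := (xmap M e z, ymap M e z).

Definition element (e : 'I_Ne) : set (R * R) := emap e @` @ref_square R.

Definition x_xi (e : 'I_Ne) := d_xi (xmap M e).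
Definition x_eta (e : 'I_Ne) := d_eta (xmap M e).
Definition y_xi (e : 'I_Ne) := d_xi (ymap M e).
Definition y_eta (e : 'I_Ne) := d_eta (ymap M e).

Definition jac (e : 'I_Ne) (z : R * R) : R :=
  x_xi e z * y_eta e z - x_eta e z * y_xi e z.

Definition face_curve (F : 'I_Ne * face) (s : R) : R * R :=
  emap F.1 (face_pt F.2 s).

(* parameter, on the face nbr F, of the point of parameter s on F *)
Definition nbr_param (F : 'I_Ne * face) (s : R) : R :=
  if face_rev M F then - s else s.

Definition face_set (F : 'I_Ne * face) : set (R * R) :=
  face_curve F @` `[-1, 1].

Record conforming_mesh (Omega : set (R * R)) : Prop := ConformingMesh {
  domain_open : open Omega;
  domain_connected : connected Omega;
  domain_nonempty : Omega !=set0;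
  mesh_smooth_x : forall e, smooth_on_square (xmap M e);
  mesh_smooth_y : forall e, smooth_on_square (ymap M e);
  mesh_injective : forall e z z', ref_square z -> ref_square z' ->
    emap e z = emap e z' -> z = z';
  mesh_jac_gt0 : forall e z, ref_square z -> 0 < jac e z;
  mesh_cover : closure Omega = \bigcup_(e in [set: 'I_Ne]) element e;
  mesh_disjoint : forall e e', e <> e' -> forall z z',
    open_ref_square z -> open_ref_square z' -> emap e z <> emap e' z';
  nbr_neq : forall F, nbr M F <> F;
  nbr_invol : forall F, nbr M (nbr M F) = F;
  nbr_curve : forall F s, -1 <= s <= 1 ->
    face_curve (nbr M F) (nbr_param F s) = face_curve F s + face_shift M F;
  shift_interior : forall F,
    ~ (face_set F `<=` closure Omega `\` Omega) -> face_shift M F = 0;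
  (* Periodic extension of mesh_disjoint; without it, a periodic neighbour
     could lie on the same side of the face. *)
  nbr_disjoint : forall F z z',
    open_ref_square z -> open_ref_square z' ->
    emap (nbr M F).1 z' <> emap F.1 z + face_shift M F
}.

(* Gradient direction of xi (faces xi = -1, 1) or eta (faces eta = -1, 1). *)
Definition face_vec (F : 'I_Ne * face) (z : R * R) : R * R :=
  if F.2.1 then (- y_xi F.1 z, x_xi F.1 z) else (y_eta F.1 z, - x_eta F.1 z).

(* outward because jac > 0 *)
Definition outward_normal (F : 'I_Ne * face) (s : R) : R * R :=
  let a := face_vec F (face_pt F.2 s) in
  (face_sgn F.2 * a.1 / norm2 a, face_sgn F.2 * a.2 / norm2 a).

End Mesh.

Section Scheme.
Variables (R : realType) (N Ne : nat) (xi : 'I_N.+1 -> R) (M : mesh R Ne).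

Local Notation w := (lgl_weight xi).
Local Notation D := (dmat xi).
Local Notation nd := (node xi).

Definition metric_identities : Prop :=
  forall (e : 'I_Ne) (q1 q2 : 'I_N.+1),
    \sum_(p < N.+1) D q2 p * y_xi M e (nd q1 p)
      = \sum_(p < N.+1) D q1 p * y_eta M e (nd p q2) /\
    \sum_(p < N.+1) D q2 p * x_xi M e (nd q1 p)
      = \sum_(p < N.+1) D q1 p * x_eta M e (nd p q2).

(* W e z is the state of element e, at a fixed time, at the reference point
   z. *)
Variable W : 'I_Ne -> R * R -> 'rV[R]_4.

Definition ftilde (e : 'I_Ne) (k : 'I_4) (p1 p2 : 'I_N.+1) : R :=
  let z := nd p1 p2 in
  y_eta M e z * flux_f (W e z) 0 k - x_eta M e z * flux_g (W e z) 0 k.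

Definition gtilde (e : 'I_Ne) (k : 'I_4) (p1 p2 : 'I_N.+1) : R :=
  let z := nd p1 p2 in
  - y_xi M e z * flux_f (W e z) 0 k + x_xi M e z * flux_g (W e z) 0 k.

(* (ftilde_k^#)_{(i,p1),p2} *)
Definition ftilde_sharp (e : 'I_Ne) (k : 'I_4) (i p1 p2 : 'I_N.+1) : R :=
  let z := nd i p2 in let z' := nd p1 p2 in
  avg (y_eta M e z) (y_eta M e z') * fsharp (W e z) (W e z') 0 k
  - avg (x_eta M e z) (x_eta M e z') * gsharp (W e z) (W e z') 0 k.

(* (gtilde_k^#)_{p1,(j,p2)} *)
Definition gtilde_sharp (e : 'I_Ne) (k : 'I_4) (p1 j p2 : 'I_N.+1) : R :=
  let z := nd p1 j in let z' := nd p1 p2 in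
  - avg (y_xi M e z) (y_xi M e z') * fsharp (W e z) (W e z') 0 k
  + avg (x_xi M e z) (x_xi M e z') * gsharp (W e z) (W e z') 0 k.

(* The two traces at the point of parameter s of the face F: the one of the
   element F.1 and the one of its neighbour across F. *)
Definition trace_in (F : 'I_Ne * face) (s : R) : 'rV[R]_4 :=
  W F.1 (face_pt F.2 s).
Definition trace_out (F : 'I_Ne * face) (s : R) : 'rV[R]_4 :=
  trace_in (nbr M F) (nbr_param M F s).

(* ftilde_k^* at (face_sgn, xi_q) for a face xi = -1, 1, and gtilde_k^* at
   (xi_q, face_sgn) for a face eta = -1, 1 *)
Definition interface_flux (e : 'I_Ne) (f : face) (k : 'I_4) (q : 'I_N.+1) : R :=
  let F := (e, f) in
  face_sgn R f * norm2 (face_vec M F (face_pt f (xi q)))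
  * lf_flux (outward_normal M F (xi q))
      (trace_in F (xi q)) (trace_out F (xi q)) 0 k.

Definition xi_minus : face := (false, false).
Definition xi_plus : face := (false, true).
Definition eta_minus : face := (true, false).
Definition eta_plus : face := (true, true).

(* Left-hand side of the scheme; dU is the nodal time derivative of U_k. *)
Definition dgsem_residual (e : 'I_Ne) (k : 'I_4) (p1 p2 : 'I_N.+1) (dU : R) : R :=
  w p1 * w p2 *
    (jac M e (nd p1 p2) * dU
     + 2 * \sum_(i < N.+1) D p1 i * ftilde_sharp e k i p1 p2
     + 2 * \sum_(j < N.+1) D p2 j * gtilde_sharp e k p1 j p2)
  + w p1 *
    ((gtilde e k p1 ord0 - interface_flux e eta_minus k p1) * (p2 == ord0)%:R
     - (gtilde e k p1 ord_max - interface_flux e eta_plus k p1)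
         * (p2 == ord_max)%:R)
  + w p2 *
    ((ftilde e k ord0 p2 - interface_flux e xi_minus k p2) * (p1 == ord0)%:R
     - (ftilde e k ord_max p2 - interface_flux e xi_plus k p2)
         * (p1 == ord_max)%:R).

End Scheme.

(* Main.v *)
(** Contract the scheme with the entropy variables [V] and sum over the nodes. LGL
    quadrature is exact up to degree [2 N - 1], so [w_i D_ij] is skew up to boundary
    terms; since the volume flux is symmetric and satisfies Tadmor's condition
    [(V_L - V_R) . f# = psi_L - psi_R], the volume sums collapse to boundary terms plus a
    multiple of the discrete metric identities, which vanishes. What remains on each
    element is a sum over face nodes of [w |a| (psi . n - V . F^* . n)]. The two
    contributions of a face node add up, after the symmetry [xi -> - xi] of the nodes
    and weights when the face is traversed backwards, to the quantity assumed to be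
    nonpositive, provided that the outward normals are opposite. Differentiating the
    matching of the face curves only gives this up to a sign, the same along the whole
    face; the wrong sign would put both elements on the same side of the face, and
    then they would overlap. *)

Require Import Defs.
From HB Require Import structures.
From mathcomp Require Import all_boot all_order all_algebra.
From mathcomp Require Import all_classical all_reals all_analysis.
From mathcomp Require Import ring lra zify.
From mathcomp Require polyorder.
Import Order.TTheory GRing.Theory Num.Theory.
Import numFieldNormedType.Exports.
Local Open Scope classical_set_scope.
Local Open Scope ring_scope.

(** * Legendre-Gauss-Lobatto quadrature *)

Section PolynomialIntegral.
Context {R : realType}.
Implicit Types p q : {poly R}.

(** Sums over interfaces are written as sums over pairs (element, face), on which [nbr] is an
    involution. Each interface then occurs twice, so the face sum is added to its own reindexing,
    and no preferred side of an interface has to be chosen. The face terms carry quadrature weights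
    as factors, so the sign of a pair is usable only because the weights are nonnegative.

    The main obstacle is the direction of the normals. Excluding the wrong sign amounts to local
    surjectivity at a boundary point of both reference squares: some interior point of one element
    must be hit by the other. This comes from minimizing a squared distance over a small box, using
    first-order expansions at the midpoint of the face and a nonzero Jacobian inside, instead of
    inverting the mapping.

    The entropy is only ever differentiated along curves: along coordinate lines, which yields the
    entropy variables, and along the time evolution of a nodal state. *)

Definition integ p : R :=
  Rintegral (@lebesgue_measure R) `[-1, 1] (fun x => p.[x]).

Lemma integ_deriv p : integ p^`() = p.[1] - p.[-1].
Proof.
have N11 : -1 < 1 :> R by lra.
rewrite /integ /Rintegral (@continuous_FTC2 _ _ (horner p)) //=.
- by apply: continuous_subspaceT => x; exact: continuous_horner.
- split => [x _||]; first exact: derivable_horner.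
  + by apply: cvg_at_right_filter; exact: continuous_horner.
  + by apply: cvg_at_left_filter; exact: continuous_horner.
- by move=> x _; rewrite derivE.
Qed.

(** Since every polynomial is a derivative, linearity and the substitution $x\to-x$ reduce through
    [integ_deriv] to evaluations at the endpoints, without integrability side conditions. *)
Lemma antideriv_exists p : exists q, q^`() = p.
Proof.
exists (\poly_(i < (size p).+1) (p`_i.-1 / i%:R)).
apply/polyP => i; rewrite coef_deriv coef_poly ltnS /=.
case: ltnP => hi; first by rewrite -[LHS]mulr_natr divfK ?pnatr_eq0.
by rewrite mul0rn nth_default.
Qed.

Lemma integD p q : integ (p + q) = integ p + integ q.
Proof.
have [[P <-] [Q <-]] := (antideriv_exists p, antideriv_exists q).
by rewrite -derivD !integ_deriv !hornerD; ring.
Qed.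

Lemma integZ c p : integ (c *: p) = c * integ p.
Proof.
have [P <-] := antideriv_exists p.
by rewrite -derivZ !integ_deriv !hornerZ; ring.
Qed.

Lemma integ0 : integ 0 = 0.
Proof. by rewrite -[0](scale0r 0) integZ mul0r. Qed.

Lemma integ_sum (I : finType) (F : I -> {poly R}) :
  integ (\sum_i F i) = \sum_i integ (F i).
Proof. by apply: (big_morph integ integD integ0). Qed.

Lemma integ_ge0 p : (forall x, -1 <= x <= 1 -> 0 <= p.[x]) -> 0 <= integ p.
Proof. by move=> hp; apply: Rintegral_ge0 => x /=; rewrite in_itv; exact: hp. Qed.

Lemma integ_compN p : integ (p \Po - 'X) = integ p.
Proof.
have [P <-] := antideriv_exists p.
have -> : P^`() \Po - 'X = (- (P \Po - 'X))^`().
  by rewrite derivN deriv_comp derivN derivX mulrN1 opprK.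
rewrite !integ_deriv !hornerN !horner_comp !hornerN !hornerX.
by rewrite (opprK 1); ring.
Qed.

Lemma integ_by_parts p q : p.[1] * q.[1] = 0 -> p.[-1] * q.[-1] = 0 ->
  integ (p^`() * q) = - integ (p * q^`()).
Proof.
move=> h1 h2; apply/eqP; rewrite -addr_eq0 -integD -derivM integ_deriv.
by rewrite !hornerM h1 h2 subr0.
Qed.

Lemma dvdp_deriv a m p : ('X - a%:P) ^+ m.+1 %| p -> ('X - a%:P) ^+ m %| p^`().
Proof.
move=> /dvdpP [q ->]; rewrite derivM deriv_exp derivXsubC mul1r /=.
apply: dvdp_add; first by rewrite exprS mulrA dvdp_mulIr.
by rewrite -mulr_natl mulrCA mulrA dvdp_mulIr.
Qed.

Lemma dvdp_derivn a m k p :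
  ('X - a%:P) ^+ (m + k) %| p -> ('X - a%:P) ^+ m %| p^`(k).
Proof.
elim: k m => [|k IH] m; first by rewrite addn0 derivn0.
by rewrite addnS -addSn derivnS => /IH; exact: dvdp_deriv.
Qed.

(** Both $\pm1$ are roots of multiplicity $n$ of $(X^2-1)^n$, and each derivative lowers the
    multiplicity by at most one. *)
Lemma root_derivn_pow (a : R) (n k : nat) : a ^+ 2 = 1 -> (k < n)%N ->
  (('X^2 - 1) ^+ n)^`(k).[a] = 0.
Proof.
move=> a2 kn; apply/rootP; rewrite -dvdp_XsubCl -['X - _]expr1.
apply: dvdp_derivn; apply: (@dvdp_trans _ (('X - a%:P) ^+ n)).
  by apply: dvdp_exp2l; rewrite add1n.
apply: dvdp_exp2r; rewrite dvdp_XsubCl; apply/rootP.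
by rewrite !hornerE a2 subrr.
Qed.

(** Integration by parts $k$ times: the boundary terms vanish by [root_derivn_pow], and $p$ loses
    one degree each time until it is zero. *)
Lemma integ_derivn_pow (n k : nat) p : (k <= n)%N -> (size p <= k)%N ->
  integ ((('X^2 - 1) ^+ n)^`(k) * p) = 0.
Proof.
elim: k p => [|k IH] p kn sp.
  by move: sp; rewrite leqn0 size_poly_eq0 => /eqP ->; rewrite mulr0 integ0.
rewrite derivnS integ_by_parts ?root_derivn_pow ?mul0r ?sqrrN ?expr1n //.
rewrite IH ?oppr0 //; first exact: ltnW.
by rewrite polyorder.size_deriv; case: (size p) sp.
Qed.

Lemma derivn_compN n p : p^`(n) \Po - 'X = (-1) ^+ n *: (p \Po - 'X)^`(n).
Proof.
elim: n => [|n IH]; first by rewrite scale1r.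
have e : (p^`(n) \Po - 'X)^`() = - (p^`(n.+1) \Po - 'X).
  by rewrite deriv_comp derivN derivX mulrN1 derivnS.
by rewrite -[LHS]opprK -e IH derivZ derivnS exprS mulN1r scaleNr.
Qed.

End PolynomialIntegral.

(** * Exactness, positivity and symmetry of the LGL rule *)

Section LegendreGaussLobatto.
Context {R : realType} {N : nat} {xi : 'I_N.+1 -> R}.
Implicit Types p q : {poly R}.
Local Notation l := (lagrange_poly xi).
Local Notation w := (lgl_weight xi).

Lemma legendre_ortho n p : (size p <= n)%N -> integ (legendre R n * p) = 0.
Proof.
by move=> sp; rewrite -scalerAl integZ integ_derivn_pow ?mulr0.
Qed.

Lemma size_legendre n : size (legendre R n) = n.+1.
Proof.
rewrite size_scale; last first.
  by rewrite invr_eq0 mulf_neq0 ?expf_neq0 ?pnatr_eq0 // -lt0n fact_gt0.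
have s : size (('X^2 - 1 : {poly R}) ^+ n) = (n + n).+1.
  have s2 : size ('X^2 - 1 : {poly R}) = 3 by rewrite -['X^2 - 1]/('X^2 - 1%:P) size_XnsubC.
  have := size_exp ('X^2 - 1 : {poly R}) n; rewrite s2 /= mul2n -addnn => <-.
  rewrite prednK // size_poly_gt0 expf_neq0 // -size_poly_eq0 s2 //.
suff H k : (k <= n + n)%N -> size (('X^2 - 1 : {poly R}) ^+ n)^`(k) = (n + n - k).+1.
  by rewrite H ?leq_addr // addnK.
elim: k => [|k IH] hk; first by rewrite subn0.
by rewrite derivnS polyorder.size_deriv IH ?(ltnW hk) //= subnS prednK // subn_gt0.
Qed.

Lemma legendre_compN n : legendre R n \Po - 'X = (-1) ^+ n *: legendre R n.
Proof.
rewrite /legendre comp_polyZ derivn_compN rmorphXn /= scalerA mulrC -scalerA.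
by congr (_ *: (_ *: (_ ^+ _)^`(_)));
  rewrite comp_polyB expr2 comp_polyM comp_polyX mulrNN comp_polyC.
Qed.

Hypothesis xiP : is_LGL xi.
Hypothesis N1 : (1 <= N)%N.

Lemma lgl_inj : injective xi.
Proof.
case: xiP => inc _ _ _ i j e; apply: val_inj; apply/eqP.
by case: ltngtP => // /inc; rewrite e ltxx.
Qed.

(** A multiple of the nodal polynomial: it has degree $N+1$ and vanishes at the $N+1$ nodes.
    Exactness is proved by Euclidean division by it. *)
Definition lobatto : {poly R} := ('X^2 - 1) * (legendre R N)^`().

Lemma size_lobatto : size lobatto = N.+2.
Proof.
have s2 : size ('X^2 - 1 : {poly R}) = 3 by rewrite -['X^2 - 1]/('X^2 - 1%:P) size_XnsubC.
have sd : size (legendre R N)^`() = N by rewrite polyorder.size_deriv size_legendre.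
by rewrite size_mul ?s2 ?sd // -size_poly_gt0 ?s2 ?sd.
Qed.

Lemma root_lobatto i : root lobatto (xi i).
Proof.
case: xiP => _ x0 xN xr; rewrite rootM.
have [->|i0] := eqVneq i ord0.
  by rewrite x0 /root !hornerE sqrrN expr1n subrr eqxx.
have [->|iN] := eqVneq i ord_max; last by rewrite xr ?orbT.
by rewrite xN /root !hornerE expr1n subrr eqxx.
Qed.

Lemma lobatto_rootP x : root lobatto x -> exists i, xi i = x.
Proof.
move=> rx; apply: contrapT => hx.
have := @max_poly_roots _ lobatto (x :: [seq xi i | i <- enum 'I_N.+1]).
rewrite size_lobatto /= size_map size_enum_ord ltnn => H.
suff: false by [].
apply: H.
- by rewrite -size_poly_eq0 size_lobatto.
- by rewrite rx; apply/allP => _ /mapP [i _ ->]; exact: root_lobatto.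
- rewrite map_inj_uniq ?enum_uniq ?andbT; last exact: lgl_inj.
  by apply/mapP => -[i _ e]; apply: hx; exists i.
Qed.

Lemma lagrange_node i j : (l i).[xi j] = (i == j)%:R.
Proof.
rewrite horner_prod; case: eqVneq => [<-|ij].
  rewrite big1 // => k ki; rewrite !hornerE mulVf // subr_eq0.
  by apply: contraNneq ki => /lgl_inj ->.
by rewrite (bigD1 j) /= 1?eq_sym // !hornerE subrr mulr0 mul0r.
Qed.

Lemma size_lagrange_poly i : (size (l i) <= N.+1)%N.
Proof.
rewrite /lagrange_poly (leq_trans (size_poly_prod_leq _ _)) //.
have -> : (\sum_(k < N.+1 | k != i)
   size ((xi i - xi k)^-1 *: ('X - (xi k)%:P)) = 2 * #|[pred k | k != i]|)%N.
  rewrite -sum1_card big_distrr /=; apply: eq_bigr => k ki.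
  rewrite size_scale ?size_XsubC // invr_eq0 subr_eq0.
  by apply: contraNneq ki => /lgl_inj ->.
by rewrite cardC1 card_ord /=; lia.
Qed.

Lemma poly_eq_nodes p q : (size p <= N.+1)%N -> (size q <= N.+1)%N ->
  (forall i, p.[xi i] = q.[xi i]) -> p = q.
Proof.
move=> sp sq e; apply/eqP; rewrite -subr_eq0; apply/eqP.
apply: (@roots_geq_poly_eq0 _ _ [seq xi i | i <- enum 'I_N.+1]).
- apply/allP => _ /mapP [i _ ->].
  by apply/rootP; rewrite hornerD hornerN e subrr.
- by rewrite map_inj_uniq ?enum_uniq //; exact: lgl_inj.
- rewrite size_map size_enum_ord (leq_trans (size_polyD _ _)) // size_polyN.
  by rewrite geq_max sp.
Qed.

Lemma size_sum_le (I : finType) (F : I -> {poly R}) n :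
  (forall i, size (F i) <= n)%N -> (size (\sum_i F i)%R <= n)%N.
Proof. by move=> h; apply: (leq_trans (size_sum _ _ _)); apply/bigmax_leqP. Qed.

Lemma lagrange_interp p : (size p <= N.+1)%N -> p = \sum_i p.[xi i] *: l i.
Proof.
move=> sp; apply: poly_eq_nodes => // [|i].
  apply: size_sum_le => i; apply: leq_trans (size_scale_leq _ _) _.
  exact: size_lagrange_poly.
rewrite horner_sum (bigD1 i) //= hornerZ lagrange_node eqxx mulr1.
rewrite big1 ?addr0 // => j /negbTE ji.
by rewrite hornerZ lagrange_node ji mulr0.
Qed.

Lemma integ_interp p : (size p <= N.+1)%N -> integ p = \sum_i w i * p.[xi i].
Proof.
move=> sp; rewrite {1}(lagrange_interp p sp) integ_sum.
by apply: eq_bigr => i _; rewrite integZ mulrC.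
Qed.

(** Integration by parts moves the derivative off $P_N'$; the factor $X^2-1$ kills the boundary
    terms, and $(q(X^2-1))'$ has degree below $N$, hence is orthogonal to $P_N$. *)
Lemma integ_lobatto q : (size q <= N.-1)%N -> integ (q * lobatto) = 0.
Proof.
move=> sq; have -> : q * lobatto = (legendre R N)^`() * (q * ('X^2 - 1)).
  by rewrite /lobatto; ring.
have h (a : R) : a ^+ 2 = 1 -> ('X^2 - 1).[a] = 0 by move=> a2; rewrite !hornerE a2 subrr.
rewrite integ_by_parts ?hornerM ?h ?sqrrN ?expr1n ?mulr0 //.
apply/eqP; rewrite oppr_eq0; apply/eqP; apply: legendre_ortho.
rewrite polyorder.size_deriv; have [->|q0] := eqVneq q 0.
  by rewrite mul0r size_poly0.
have s2 : size ('X^2 - 1 : {poly R}) = 3 by rewrite -['X^2 - 1]/('X^2 - 1%:P) size_XnsubC.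
by have := size_polyMleq q ('X^2 - 1); rewrite s2; move: (size (q * ('X^2 - 1))%R) => a; lia.
Qed.

(** In the division by [lobatto], the quotient part integrates to zero by [integ_lobatto], while the
    remainder is integrated exactly by interpolation and has the nodal values of $p$. As [size] is
    the degree plus one, the bound means degree at most $2N-1$. *)
Lemma lgl_exact p : (size p <= 2 * N)%N -> integ p = \sum_i w i * p.[xi i].
Proof.
move=> sp; have ne : lobatto != 0 by rewrite -size_poly_eq0 size_lobatto.
rewrite (divp_eq p lobatto) integD integ_lobatto ?add0r; last first.
  rewrite size_divp // size_lobatto /=.
  by move: (size p) sp => a; lia.
rewrite integ_interp; last by rewrite -ltnS -size_lobatto ltn_modp.
apply: eq_bigr => i _; rewrite hornerD hornerM (rootP (root_lobatto i)).
by rewrite mulr0 add0r.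
Qed.

(** The left side is the quadrature of $(l_il_j)'$, whose degree is at most $2N-1$; its exact
    integral consists of endpoint values, and the endpoints are nodes. *)
Lemma lgl_sbp i j : w i * dmat xi i j + w j * dmat xi j i =
  ((i == ord_max) && (j == ord_max))%:R - ((i == ord0) && (j == ord0))%:R.
Proof.
case: (xiP) => _ x0 xN _.
transitivity (integ (l i * l j)^`()); last first.
  have hN k : (l k).[1] = (k == ord_max)%:R by rewrite -lagrange_node xN.
  have h0 k : (l k).[-1] = (k == ord0)%:R by rewrite -lagrange_node x0.
  by rewrite integ_deriv !hornerM !h0 !hN -!natrM !mulnb.
rewrite lgl_exact; last first.
  rewrite polyorder.size_deriv; have := size_polyMleq (l i) (l j).
  have := size_lagrange_poly i; have := size_lagrange_poly j.
  by move: (size (l i)) (size (l j)) (size (l i * l j)%R) => a b c; lia.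
under eq_bigr => k _ do rewrite derivM hornerD !hornerM !lagrange_node mulrDr.
rewrite big_split addrC /=; congr (_ + _); apply/esym.
  rewrite (bigD1 j) //= eqxx mulr1 big1 ?addr0 // => k /negbTE.
  by rewrite eq_sym => ->; rewrite !mulr0.
rewrite (bigD1 i) //= eqxx mul1r big1 ?addr0 // => k /negbTE.
by rewrite eq_sym => ->; rewrite mul0r mulr0.
Qed.

(** Differentiation of the interpolant of the constant 1. *)
Lemma dmat_row_sum i : \sum_j dmat xi i j = 0.
Proof.
have := lagrange_interp 1; rewrite size_poly1 => /(_ isT) /(congr1 (fun p => p^`().[xi i])).
rewrite derivC horner0 linear_sum horner_sum => e; rewrite [RHS]e; apply: eq_bigr => j _.
by rewrite hornerC scale1r.
Qed.

Definition node_poly (P : pred 'I_N.+1) : {poly R} :=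
  \prod_(k < N.+1 | P k) ('X - (xi k)%:P).

Lemma node_poly0 (P : pred 'I_N.+1) j : P j -> (node_poly P).[xi j] = 0.
Proof. by move=> Pj; rewrite horner_prod (bigD1 j) //= !hornerE subrr mul0r. Qed.

Lemma node_poly_neq0 (P : pred 'I_N.+1) j : ~~ P j -> (node_poly P).[xi j] != 0.
Proof.
move=> Pj; rewrite horner_prod; apply/prodf_neq0 => k Pk; rewrite !hornerE subr_eq0.
by apply: contraNneq Pj => /lgl_inj ->.
Qed.

Lemma size_node_poly (P : pred 'I_N.+1) : size (node_poly P) = #|P|.+1.
Proof.
rewrite /node_poly size_prod => [|k _]; last by rewrite polyXsubC_eq0.
under eq_bigr do rewrite size_XsubC.
have -> : (\sum_(i < N.+1 | P i) 2 = #|P| + #|P|)%N.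
  by rewrite addnn -mul2n -sum1_card big_distrr.
by rewrite subSn ?addnK ?leq_addr.
Qed.

(** Exactness gives $w_i\,p(\xi_i)=\int p\ge0$. The obvious choice $p=l_i^2$ has degree $2N$, one
    too many, hence the more careful test polynomials below. *)
Lemma weight_ge0_of p i : (size p <= 2 * N)%N ->
  (forall x, -1 <= x <= 1 -> 0 <= p.[x]) ->
  (forall j, j != i -> p.[xi j] = 0) -> 0 < p.[xi i] -> 0 <= w i.
Proof.
move=> sp p0 pz pi; have := integ_ge0 p p0.
rewrite lgl_exact // (bigD1 i) //= big1 ?addr0 => [|j /pz ->]; last by rewrite mulr0.
by rewrite pmulr_lge0.
Qed.

(* The test polynomials are the square of the product over the interior nodes other
   than [i], times [1 - x], [1 + x] or [1 - x^2], so their degree is at most [2 N - 1]. *)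
Lemma lgl_weight_ge0 i : 0 <= w i.
Proof.
case: (xiP) => inc x0 xN _.
(* When [i] is an endpoint the list has a repetition and [P] has $N-1$ members, which leaves room
   for one linear factor; otherwise it has $N-2$ members and a quadratic factor fits. *)
pose P := [pred k | k \notin [:: ord0; ord_max; i]].
have o0N : ord0 != ord_max :> 'I_N.+1 by rewrite -val_eqE /=; lia.
have cP : (#|P| + #|[:: ord0; ord_max; i]| = N.+1)%N by rewrite addnC cardC card_ord.
have c2 : (2 <= #|[:: ord0; ord_max; i]|)%N.
  have <- : #|[:: ord0; ord_max : 'I_N.+1]| = 2%N by rewrite (card_uniqP _) //= inE o0N.
  by apply/subset_leq_card/fintype.subsetP => k; rewrite !inE => /orP [] ->; rewrite ?orbT.
have Pi : ~~ P i by rewrite /= !inE eqxx !orbT.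
have sqsize (r : {poly R}) s : (size r <= s)%N -> (s + 2 * #|P| <= 2 * N)%N ->
    (size (r * node_poly P ^+ 2)%R <= 2 * N)%N.
  move=> sr; apply: leq_trans; apply: leq_trans (size_polyMleq _ _) _.
  have := size_poly_exp_leq (node_poly P) 2; rewrite size_node_poly mulnC.
  by move: (#|P|) (size (node_poly P ^+ 2)%R) => a b; lia.
have hz (r : {poly R}) j : P j -> (r * node_poly P ^+ 2).[xi j] = 0.
  by move=> Pj; rewrite hornerM horner_exp node_poly0 // expr0n mulr0.
have hz0 (r : {poly R}) x : r.[x] = 0 -> (r * node_poly P ^+ 2).[x] = 0.
  by move=> rx; rewrite hornerM rx mul0r.
have hge (r : {poly R}) x : 0 <= r.[x] -> 0 <= (r * node_poly P ^+ 2).[x].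
  by move=> r0; rewrite hornerM horner_exp mulr_ge0 // sqr_ge0.
have hgt (r : {poly R}) : 0 < r.[xi i] -> 0 < (r * node_poly P ^+ 2).[xi i].
  move=> r0; rewrite hornerM horner_exp mulr_gt0 // exprn_even_gt0 //=.
  exact: node_poly_neq0.
have notP j : ~~ P j -> j != i -> j = ord0 \/ j = ord_max.
  by rewrite /= !inE negbK => /or3P [] /eqP -> //; [left|right|rewrite eqxx].
have [ei|i0] := eqVneq i ord0.
  apply: (@weight_ge0_of ((1 - 'X) * node_poly P ^+ 2)).
  - apply: (sqsize _ 2); first by rewrite -opprB size_polyN size_XsubC.
    by move: cP c2; move: (#|P|) (#|_|) => a b; lia.
  - by move=> x hx; apply: hge; rewrite !hornerE; lra.
  - move=> j ji; have [Pj|/notP] := boolP (P j); first exact: hz.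
    move=> /(_ ji) [e|->]; first by move: ji; rewrite e ei eqxx.
    by apply: hz0; rewrite !hornerE xN subrr.
  - by apply: hgt; rewrite ei x0 !hornerE; lra.
have [ei|iN] := eqVneq i ord_max.
  apply: (@weight_ge0_of ((1 + 'X) * node_poly P ^+ 2)).
  - apply: (sqsize _ 2); first by rewrite addrC -polyC1 size_XaddC.
    by move: cP c2; move: (#|P|) (#|_|) => a b; lia.
  - by move=> x hx; apply: hge; rewrite !hornerE; lra.
  - move=> j ji; have [Pj|/notP] := boolP (P j); first exact: hz.
    move=> /(_ ji) [->|e]; last by move: ji; rewrite e ei eqxx.
    by apply: hz0; rewrite !hornerE x0 subrr.
  - by apply: hgt; rewrite ei xN !hornerE; lra.
have xi0 : -1 < xi i by rewrite -x0; apply: inc; rewrite lt0n.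
have xi1 : xi i < 1.
  rewrite -xN; apply: inc; rewrite ltn_neqAle -ltnS ltn_ord andbT.
  by apply: contraNneq iN => e; apply/eqP/val_inj.
apply: (@weight_ge0_of ((1 - 'X) * (1 + 'X) * node_poly P ^+ 2)).
- apply: (sqsize _ 3).
    apply: leq_trans (size_polyMleq _ _) _.
    by rewrite -opprB size_polyN size_XsubC addrC -polyC1 size_XaddC.
  move: cP; rewrite (card_uniqP _) /= ?inE ?negb_or ?o0N ?andbT //=; first lia.
  by rewrite eq_sym i0 eq_sym iN.
- by move=> x hx; apply: hge; rewrite !hornerE; apply: mulr_ge0; lra.
- move=> j ji; have [Pj|/notP] := boolP (P j); first exact: hz.
  by move=> /(_ ji) [->|->]; apply: hz0; rewrite !hornerE ?x0 ?xN subrr ?(mul0r, mulr0).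
- by apply: hgt; rewrite !hornerE; apply: mulr_gt0; lra.
Qed.

(** By the parity of $P_N$, $-\xi_i$ is again a root of [lobatto], and those roots are all nodes. *)
Lemma node_opp_exists i : exists j, xi j = - xi i.
Proof.
apply: lobatto_rootP; apply/rootP; move/rootP: (root_lobatto i).
rewrite !hornerM; have := congr1 (fun p => p^`().[xi i]) (legendre_compN N).
move: (legendre R N) => P.
rewrite deriv_comp derivN derivX mulrN1 hornerN horner_comp hornerN hornerX derivZ hornerZ.
move=> /eqP; rewrite eqr_oppLR => /eqP ->.
have -> : ('X^2 - 1).[- xi i] = ('X^2 - 1).[xi i] by rewrite !hornerE sqrrN.
by move=> e; rewrite mulrN mulrCA e mulr0 oppr0.
Qed.

Definition node_opp (i : 'I_N.+1) : 'I_N.+1 :=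
  odflt i [pick j | xi j == - xi i].

Lemma node_oppE i : xi (node_opp i) = - xi i.
Proof.
rewrite /node_opp; case: pickP => [j /eqP //|h].
by have [j e] := node_opp_exists i; have := h j; rewrite e eqxx.
Qed.

Lemma node_oppK : involutive node_opp.
Proof. by move=> i; apply: lgl_inj; rewrite !node_oppE opprK. Qed.

(** Reflection maps the Lagrange polynomial of a node to that of the opposite node and preserves the
    integral. *)
Lemma weight_opp i : w (node_opp i) = w i.
Proof.
rewrite -[LHS]/(integ _) -[RHS]/(integ _) -[RHS]integ_compN; congr integ.
apply: poly_eq_nodes => [||j].
- exact: size_lagrange_poly.
- by rewrite size_comp_poly2 ?size_lagrange_poly // size_polyN size_polyX.
rewrite horner_comp hornerN hornerX -node_oppE !lagrange_node.
by congr (_%:R); rewrite -[in RHS](inj_eq (inv_inj node_oppK)) node_oppK.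
Qed.

End LegendreGaussLobatto.

(** * Entropy variables and two-point fluxes *)

Section DirectionalDerivative.
Context {R : realType} {V : normedModType R}.

(** Turns directional derivatives into one-variable derivatives along a line, where product,
    quotient and chain rules are available. *)
Lemma line_quotient (f : V -> R) a v :
  (fun h : R => h^-1 *: ((f \o shift a) (h *: v) - f a)) =
  (fun h : R => h^-1 *: (((fun s : R => f (s *: v + a)) \o shift 0) (h *: (1 : R))
                        - f ((0 : R) *: v + a))).
Proof. by apply/funext => h; rewrite /= addr0 scale0r add0r [h *: 1]mulr1. Qed.

Lemma derive_line (f : V -> R) a v :
  'D_v f a = 'D_1 (fun s : R => f (s *: v + a)) 0.
Proof. by rewrite /derive line_quotient. Qed.

Lemma derivable_line (f : V -> R) a v :
  derivable f a v <-> derivable (fun s : R => f (s *: v + a)) 0 1.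
Proof. by rewrite /derivable line_quotient. Qed.

End DirectionalDerivative.

Section EntropyVariables.
Context {R : realType}.
Implicit Types (U UL UR : 'rV[R]_4).
Local Notation gam := (gamma R).

Lemma sum_ord4 (F : 'I_4 -> R) : \sum_k F k =
  F (@Ordinal 4 0 isT) + F (@Ordinal 4 1 isT) + F (@Ordinal 4 2 isT)
  + F (@Ordinal 4 3 isT).
Proof.
rewrite !big_ord_recl big_ord0 addr0 !addrA.
by congr (F _ + F _ + F _ + F _); apply: val_inj.
Qed.

Lemma gamma_gt1 : 0 < gam - 1.
Proof. by rewrite /gamma; lra. Qed.

(** Closed form of the gradient of the entropy; [entropy_varE] identifies it with [entropy_var] on
    admissible states. *)
Definition evar U : 'rV[R]_4 :=
  vec4 ((gam - ln (pressure U * rho U `^ (- gam))) / (gam - 1)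
        - rho U * (velx U ^+ 2 + vely U ^+ 2) / (2 * pressure U))
       (rho U * velx U / pressure U) (rho U * vely U / pressure U)
       (- (rho U / pressure U)).

Lemma is_derive_mul (f g : R -> R) (t df dg : R) :
  is_derive t (1 : R) f df -> is_derive t (1 : R) g dg ->
  is_derive t (1 : R) (fun s => f s * g s) (df * g t + f t * dg).
Proof.
move=> hf hg; apply: (is_derive_eq (is_deriveM hf hg)).
by rewrite /GRing.scale /= ; ring.
Qed.

Lemma is_derive_add (f g : R -> R) (t df dg : R) :
  is_derive t (1 : R) f df -> is_derive t (1 : R) g dg ->
  is_derive t (1 : R) (fun s => f s + g s) (df + dg).
Proof. by move=> hf hg; apply: (is_deriveD hf hg). Qed.

Lemma is_derive_scal (a : R) (f : R -> R) (t df : R) :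
  is_derive t (1 : R) f df -> is_derive t (1 : R) (fun s => a * f s) (a * df).
Proof.
move=> hf; apply: (is_derive_eq (is_derive_mul _ _ _ _ _ (is_derive_cst a t 1) hf)).
by rewrite mul0r add0r.
Qed.

Lemma is_derive_div (f g : R -> R) (t df dg : R) : g t != 0 ->
  is_derive t (1 : R) f df -> is_derive t (1 : R) g dg ->
  is_derive t (1 : R) (fun s => f s / g s) ((df - f t / g t * dg) / g t).
Proof.
move=> g0 hf hg; apply: (is_derive_eq (is_derive_mul _ _ _ _ _ hf (is_deriveV g0 hg))).
by rewrite /GRing.scale /=; field.
Qed.

Lemma is_derive_comp (f g : R -> R) (t df dg : R) :
  is_derive (g t) (1 : R) f df -> is_derive t (1 : R) g dg ->
  is_derive t (1 : R) (fun s => f (g s)) (df * dg).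
Proof. by move=> hf hg; apply: is_derive1_comp. Qed.

(** Stated along an arbitrary curve so as to serve twice: on coordinate lines it computes the
    entropy variables, and on the time evolution of a node it gives $\partial_tS=\bm
    V\cdot\partial_t\bm U$. *)
Lemma is_derive_entropy (c : R -> 'rV[R]_4) (d : 'I_4 -> R) (t : R) :
  (forall k : 'I_4, is_derive t (1 : R) (fun s => c s 0 k) (d k)) ->
  admissible (c t) ->
  is_derive t (1 : R) (fun s => entropy (c s)) (\sum_k evar (c t) 0 k * d k).
Proof.
move=> dc [r0 p0]; have g0 := gamma_gt1.
set d0 := d (@Ordinal 4 0 isT); set d1 := d (@Ordinal 4 1 isT).
set d2 := d (@Ordinal 4 2 isT); set d3 := d (@Ordinal 4 3 isT).
have rn0 : rho (c t) != 0 by rewrite gt_eqF.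
have hr : is_derive t (1 : R) (fun s => rho (c s)) d0 := dc _.
have hu := is_derive_div _ _ _ _ _ rn0 (dc (@Ordinal 4 1 isT)) hr.
have hv := is_derive_div _ _ _ _ _ rn0 (dc (@Ordinal 4 2 isT)) hr.
(* The differential of $p=(\gamma-1)(E-(m_1^2+m_2^2)/(2\rho))$ with $m=\rho(u,v)$. *)
pose dp := (gam - 1) * (d3 + (velx (c t) ^+ 2 + vely (c t) ^+ 2) / 2 * d0
                        - velx (c t) * d1 - vely (c t) * d2).
have hp : is_derive t (1 : R) (fun s => pressure (c s)) dp.
  have hq := is_derive_add _ _ _ _ _ (is_derive_mul _ _ _ _ _ hu hu)
               (is_derive_mul _ _ _ _ _ hv hv).
  have h := is_derive_scal (gam - 1) _ _ _ (is_derive_add _ _ _ _ _ (dc (@Ordinal 4 3 isT))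
     (is_derive_scal (- 2^-1) _ _ _ (is_derive_mul _ _ _ _ _ hr hq))).
  have e : (fun s => pressure (c s)) = 
     (fun s => (gam - 1) * (c s 0 (@Ordinal 4 3 isT) + - 2^-1 * (rho (c s) *
       (velx (c s) * velx (c s) + vely (c s) * vely (c s))))).
    by apply/funext => s; rewrite /pressure /energy; field.
  rewrite e; apply: (is_derive_eq h).
  rewrite /dp -/d1 -/d2 -/d3 -/(velx (c t)) -/(vely (c t)).
  by field.
have hpow : is_derive t (1 : R) (fun s => rho (c s) `^ (- gam))
    (- gam * rho (c t) `^ (- gam - 1) * d0).
  apply: (is_derive_comp (fun x => x `^ (- gam)) _ _ _ _ _ hr).
  exact: is_derive1_powR.
have Pp : 0 < pressure (c t) * rho (c t) `^ (- gam) by rewrite mulr_gt0 // powR_gt0.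
have hln := is_derive_comp (@ln R) (fun s => pressure (c s) * rho (c s) `^ (- gam))
  _ _ _ (is_derive1_ln Pp) (is_derive_mul _ _ _ _ _ hp hpow).
have hS := is_derive_scal (- (gam - 1)^-1) _ _ _ (is_derive_mul _ _ _ _ _ hr hln).
have e : (fun s => entropy (c s)) = (fun s => - (gam - 1)^-1 * (rho (c s) *
    ln (pressure (c s) * rho (c s) `^ (- gam)))).
  by apply/funext => s; rewrite /entropy mulrC mulNr mulrN.
rewrite e; apply: (is_derive_eq hS).
rewrite sum_ord4 !mxE /= -/d0 -/d1 -/d2 -/d3 /=.
have -> : rho (c t) `^ (- gam - 1) = rho (c t) `^ (- gam) / rho (c t).
  by rewrite powRD ?rn0 ?implybT // powR_inv1 ?ltW.
rewrite /dp.
have : rho (c t) `^ (- gam) != 0 by rewrite gt_eqF ?powR_gt0.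
have : pressure (c t) != 0 by rewrite gt_eqF.
have : gam - 1 != 0 by rewrite gt_eqF.
move: (rho (c t) `^ (- gam)) (pressure (c t)) (velx (c t)) (vely (c t))
  (ln (pressure (c t) * rho (c t) `^ (- gam))) rn0.
move=> P p u v L rn0 gn0 pn0 Pn0; field.
by rewrite ?rn0 ?gn0 ?pn0 ?Pn0.
Qed.

Lemma entropy_varE U : admissible U -> entropy_var U = evar U.
Proof.
move=> aU; apply/rowP => k; rewrite mxE.
have h := @is_derive_entropy (fun s : R => s *: delta_mx 0 k + U) (fun j => (j == k)%:R) 0.
rewrite derive_line (@derive_val _ _ _ _ _ _ _ (h _ _)).
- rewrite scale0r add0r (bigD1 k) //= eqxx mulr1 big1 ?addr0 // => j /negbTE ->.
  by rewrite mulr0.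
- move=> j.
  have := is_derive_add _ _ _ _ _
    (is_derive_mul _ _ _ _ _ (is_derive_id (0 : R) 1)
      (is_derive_cst ((delta_mx 0 k : 'rV[R]_4) 0 j) (0 : R) 1))
    (is_derive_cst (U 0 j) (0 : R) 1).
  have e : (fun s : R => (s *: delta_mx 0 k + U) 0 j) =
      (fun s : R => s * (delta_mx 0 k : 'rV[R]_4) 0 j + U 0 j) by apply/funext => s; rewrite !mxE.
  by rewrite e => h1; apply: (is_derive_eq h1); rewrite mxE eqxx /=; ring.
- by rewrite scale0r add0r.
Qed.

(** With $p=\rho/(2\beta)$, the logarithm splits into $\log\rho$ and $\log\beta$, the two quantities
    to which the logarithmic means of the volume flux are adapted. *)
Lemma evarE U : admissible U -> evar U =
  vec4 ((gam + ln 2 + ln (beta U)) / (gam - 1) + ln (rho U)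
        - beta U * (velx U ^+ 2 + vely U ^+ 2))
       (2 * beta U * velx U) (2 * beta U * vely U) (- (2 * beta U)).
Proof.
move=> [r0 p0]; have g0 := gamma_gt1.
have rn0 : rho U != 0 by rewrite gt_eqF.
have pn0 : pressure U != 0 by rewrite gt_eqF.
have gn0 : gam - 1 != 0 by rewrite gt_eqF.
have -> : ln (beta U) = ln (rho U) - ln 2 - ln (pressure U).
  have p2 : 0 < 2 * pressure U by rewrite mulr_gt0.
  rewrite /beta (ln_div r0 p2) (@lnM _ 2 (pressure U)) ?posrE //.
  by rewrite opprD addrA.
rewrite /evar lnM ?posrE ?powR_gt0 // ln_powR /beta.
by congr vec4; field; rewrite ?rn0 ?gn0 ?pn0.
Qed.

Lemma beta_gt0 U : admissible U -> 0 < beta U.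
Proof. by move=> [r0 p0]; rewrite /beta divr_gt0 // mulr_gt0. Qed.

(** The division-free form also covers [a == b], so Tadmor's condition needs no case distinction. *)
Lemma logmean_ln (a b : R) : 0 < a -> 0 < b ->
  logmean a b * (ln a - ln b) = a - b.
Proof.
move=> a0 b0; rewrite /logmean; case: eqVneq => [->|ab]; first by rewrite !subrr mulr0.
by rewrite divfK // subr_eq0; apply: contraNneq ab => /ln_inj ->.
Qed.

Lemma logmean_neq0 (a b : R) : 0 < a -> 0 < b -> logmean a b != 0.
Proof.
move=> a0 b0; have := logmean_ln a b a0 b0; rewrite /logmean.
case: eqVneq => [_|ab]; first by rewrite gt_eqF.
by move=> h; apply: contraNneq ab => e; rewrite -subr_eq0 -h e mul0r.
Qed.

Lemma logmeanC (a b : R) : logmean a b = logmean b a.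
Proof.
rewrite /logmean eq_sym; case: eqVneq => [//|_].
by rewrite -opprB -[ln a - _]opprB invrN mulrNN.
Qed.

Lemma avgC (a b : R) : avg a b = avg b a.
Proof. by rewrite /avg addrC. Qed.

Lemma phatC UL UR : phat UL UR = phat UR UL.
Proof. by rewrite /phat [avg (rho UL) _]avgC [avg (beta UL) _]avgC. Qed.

Lemma hhatC UL UR : hhat UL UR = hhat UR UL.
Proof.
rewrite /hhat phatC [logmean (rho UL) _]logmeanC [logmean (beta UL) _]logmeanC.
rewrite [avg (velx UL) _]avgC [avg (vely UL) _]avgC.
by rewrite [avg (velx UL ^+ 2) _]avgC [avg (vely UL ^+ 2) _]avgC.
Qed.

Lemma fsharpC UL UR : fsharp UL UR = fsharp UR UL.
Proof.
rewrite /fsharp phatC hhatC [logmean (rho UL) _]logmeanC.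
by rewrite [avg (velx UL) _]avgC [avg (vely UL) _]avgC.
Qed.

Lemma gsharpC UL UR : gsharp UL UR = gsharp UR UL.
Proof.
rewrite /gsharp phatC hhatC [logmean (rho UL) _]logmeanC.
by rewrite [avg (velx UL) _]avgC [avg (vely UL) _]avgC.
Qed.

Lemma avgxx (a : R) : avg a a = a.
Proof. by rewrite /avg; lra. Qed.

Lemma logmeanxx (a : R) : logmean a a = a.
Proof. by rewrite /logmean eqxx. Qed.

Lemma phatxx U : admissible U -> phat U U = pressure U.
Proof.
move=> [r0 p0]; rewrite /phat !avgxx /beta; field.
by rewrite !gt_eqF.
Qed.

Lemma hhatxx U : admissible U -> rho U * hhat U U = energy U + pressure U.
Proof.
move=> aU; rewrite /hhat phatxx // !avgxx !logmeanxx.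
have {1}-> : energy U = pressure U / (gam - 1) + rho U * (velx U ^+ 2 + vely U ^+ 2) / 2.
  rewrite /pressure; have := gamma_gt1; move=> g0; field; rewrite gt_eqF //.
case: aU => r0 p0; rewrite /beta; have g0 := gamma_gt1.
move: (pressure U) (velx U) (vely U) p0 => p u v p0.
by field; rewrite !gt_eqF.
Qed.

Lemma fsharpxx U : admissible U -> fsharp U U = flux_f U.
Proof.
move=> aU; rewrite /fsharp /flux_f /= phatxx // logmeanxx !avgxx -hhatxx //.
by congr vec4; ring.
Qed.

Lemma gsharpxx U : admissible U -> gsharp U U = flux_g U.
Proof.
move=> aU; rewrite /gsharp /flux_g /= phatxx // logmeanxx !avgxx -hhatxx //.
by congr vec4; ring.
Qed.

Lemma tadmor_fsharp UL UR : admissible UL -> admissible UR ->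
  \sum_k (evar UL 0 k - evar UR 0 k) * fsharp UL UR 0 k = psi_f UL - psi_f UR.
Proof.
move=> aL aR; rewrite !evarE // sum_ord4 !mxE /= /psi_f /hhat /phat /avg.
case: (aL) (aR) => rL _ [rR _]; have bL := beta_gt0 UL aL; have bR := beta_gt0 UR aR.
have := logmean_ln _ _ rL rR; have := logmean_neq0 _ _ rL rR.
have := logmean_ln _ _ bL bR; have := logmean_neq0 _ _ bL bR.
have bb : beta UL + beta UR != 0 by rewrite gt_eqF ?addr_gt0.
have gn : gam - 1 != 0 by rewrite gt_eqF // gamma_gt1.
move: (gam + ln 2) (gam - 1) gn (logmean _ _) (logmean _ _) bb => c g gn rl bl.
move: (ln (rho UL)) (ln (rho UR)) (ln (beta UL)) (ln (beta UR)).
move: (beta UL) (beta UR) (rho UL) (rho UR) (velx UL) (velx UR) (vely UL) (vely UR).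
move=> b1 b2 r1 r2 u1 u2 v1 v2 x1 x2 y1 y2 bb bl0 eb rl0 er.
(* The logarithms are by now free variables, tied to the states only through [er] and [eb].
   Eliminating [r1] and [b1] leaves a rational identity. *)
have e1 : r1 = r2 + rl * (x1 - x2) by rewrite er; ring.
have e2 : b1 = b2 + bl * (y1 - y2) by rewrite eb; ring.
rewrite e2 in bb *; rewrite e1; field.
by rewrite gn rl0 bl0 bb.
Qed.

Lemma tadmor_gsharp UL UR : admissible UL -> admissible UR ->
  \sum_k (evar UL 0 k - evar UR 0 k) * gsharp UL UR 0 k = psi_g UL - psi_g UR.
Proof.
move=> aL aR; rewrite !evarE // sum_ord4 !mxE /= /psi_g /hhat /phat /avg.
case: (aL) (aR) => rL _ [rR _]; have bL := beta_gt0 UL aL; have bR := beta_gt0 UR aR.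
have := logmean_ln _ _ rL rR; have := logmean_neq0 _ _ rL rR.
have := logmean_ln _ _ bL bR; have := logmean_neq0 _ _ bL bR.
have bb : beta UL + beta UR != 0 by rewrite gt_eqF ?addr_gt0.
have gn : gam - 1 != 0 by rewrite gt_eqF // gamma_gt1.
move: (gam + ln 2) (gam - 1) gn (logmean _ _) (logmean _ _) bb => c g gn rl bl.
move: (ln (rho UL)) (ln (rho UR)) (ln (beta UL)) (ln (beta UR)).
move: (beta UL) (beta UR) (rho UL) (rho UR) (velx UL) (velx UR) (vely UL) (vely UR).
move=> b1 b2 r1 r2 u1 u2 v1 v2 x1 x2 y1 y2 bb bl0 eb rl0 er.
have e1 : r1 = r2 + rl * (x1 - x2) by rewrite er; ring.
have e2 : b1 = b2 + bl * (y1 - y2) by rewrite eb; ring.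
rewrite e2 in bb *; rewrite e1; field.
by rewrite gn rl0 bl0 bb.
Qed.

End EntropyVariables.

(** * Orientation of neighbouring faces *)

Section DerivativeOnSegment.
Context {R : realType}.

(** The derivative is two-sided, so it can be read off from increments pointing into the segment;
    this covers the endpoints, which are LGL nodes. *)
Lemma is_derive_cst_segment (f : R -> R) (s d c : R) : -1 <= s <= 1 ->
  (forall x, -1 <= x <= 1 -> f x = c) -> is_derive s (1 : R) f d -> d = 0.
Proof.
move=> hs fc [df dE]; apply/eqP; rewrite -normr_le0; apply/ler_addgt0Pr => e e0.
rewrite add0r; have /cvgrPdist_le/(_ e e0) :
    (fun h : R => h^-1 *: ((f \o shift s) (h *: (1 : R)) - f s)) @ 0^' --> d.
  by rewrite -dE; exact: df.
rewrite /dnbhs /within /= => /nbhs_ballP [r /= r0 hr].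
pose m := Num.min (r / 2) 1.
have [m0 mr m1] : [/\ 0 < m, m < r & m <= 1].
  rewrite /m; split; first by rewrite lt_min ltr01 andbT; lra.
    by rewrite gt_min; apply/orP; left; lra.
  by rewrite ge_min lexx orbT.
(* A step towards the midpoint; since $m\le1$ it stays in the segment. *)
pose h := if 0 <= s then - m else m.
have hm : `|h| = m by rewrite /h; case: ifP; rewrite ?normrN gtr0_norm.
have h0 : h != 0 by rewrite -normr_gt0 hm.
have hsh : -1 <= h + s <= 1 by rewrite /h; case: ifP => h0s; lra.
have := hr h; rewrite /ball /= sub0r normrN hm => /(_ mr h0).
by rewrite [h *: 1]mulr1 !fc // subrr scaler0 subr0.
Qed.

Lemma mvt_zero (f df : R -> R) (x : R) :
  (forall y, `|y| <= `|x| -> is_derive y (1 : R) f (df y)) ->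
  exists2 c, `|c| <= `|x| & f x - f 0 = df c * x.
Proof.
move=> hd; have cont (a b : R) : (forall y, a <= y <= b -> `|y| <= `|x|) ->
    {within `[a, b], continuous f}.
  move=> hab; apply: derivable_within_continuous => y; rewrite in_itv /= => /hab /hd h.
  exact: ex_derive.
have [x0|x0] := leP 0 x.
  have inb y : 0 <= y <= x -> `|y| <= `|x| by move=> /andP [y0 yx]; rewrite !ger0_norm.
  have [y|c|] := @MVT_segment _ f df 0 x x0.
  - by rewrite in_itv /= => /andP [y0 yx]; apply: hd; apply: inb; rewrite !ltW.
  - exact: cont.
  - by move=> c; rewrite in_itv /= => hc ->; exists c; rewrite ?inb // subr0.
have inb y : x <= y <= 0 -> `|y| <= `|x|.
  by move=> /andP [y0 yx]; rewrite !ler0_norm // ?lerN2 // ltW.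
have [y||] := @MVT_segment _ f df x 0 (ltW x0).
- by rewrite in_itv /= => /andP [y0 yx]; apply: hd; apply: inb; rewrite !ltW.
- exact: cont.
- move=> c; rewrite in_itv /= => hc e; exists c; rewrite ?inb //.
  by rewrite -[LHS]opprB e; ring.
Qed.

Lemma is_derive_along (g : R * R -> R) (z v : R * R) (c s : R) (y : R -> R * R) :
  derivable g z v -> (forall h, y h = ((h - s) * c) *: v + z) ->
  is_derive s (1 : R) (fun h => g (y h)) (c * 'D_v g z).
Proof.
move=> dg yE; have e : (fun h => g (y h)) = (fun h => (fun k : R => g (k *: v + z)) ((h - s) * c)).
  by apply/funext => h; rewrite yE.
have h1 : is_derive s (1 : R) (fun h : R => (h - s) * c) c.
  apply: (is_derive_eq (is_derive_mul _ _ _ _ _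
    (is_derive_add _ _ _ _ _ (is_derive_id s 1) (is_derive_cst (- s) s 1))
    (is_derive_cst c s 1))).
  by rewrite /cst /=; ring.
rewrite e mulrC derive_line; apply: (is_derive_comp (fun k : R => g (k *: v + z)) _ _ _ _ _ h1).
by rewrite subrr mul0r; apply: (DeriveDef ((derivable_line g z v).1 dg)).
Qed.

End DerivativeOnSegment.

(** * First-order expansions and local solvability *)

Section LinearApproximation.
Context {R : realType}.
Implicit Types G : R * R -> R.

Definition near0 (P : R * R -> Prop) :=
  exists2 d : R, 0 < d & forall p, `|p.1| < d -> `|p.2| < d -> P p.

(** Differentiability at the origin with gradient [(A, B)], phrased with explicit radii so that
    several expansions can be used on a common square. *)
Definition linear_at0 G (A B : R) := forall e, 0 < e -> near0 (fun p =>
  `|G p - G 0 - A * p.1 - B * p.2| <= e * (`|p.1| + `|p.2|)).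

Lemma near0_and (P Q : R * R -> Prop) :
  near0 P -> near0 Q -> near0 (fun p => P p /\ Q p).
Proof.
move=> [d d0 hd] [d' d0' hd']; exists (Num.min d d'); first by rewrite lt_min d0.
by move=> p; rewrite !lt_min => /andP [a b] /andP [a' b']; split; [apply: hd|apply: hd'].
Qed.

Lemma linear_at0_comb G1 G2 A1 A2 B1 B2 c1 c2 c :
  linear_at0 G1 A1 B1 -> linear_at0 G2 A2 B2 ->
  linear_at0 (fun p => c1 * G1 p + c2 * G2 p + c) (c1 * A1 + c2 * A2) (c1 * B1 + c2 * B2).
Proof.
move=> h1 h2 e e0; pose k := e / (`|c1| + `|c2| + 1).
have k1 : 0 < `|c1| + `|c2| + 1 by rewrite ltr_wpDl ?addr_ge0.
have k0 : 0 < k by rewrite divr_gt0.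
have [d d0 hd] := near0_and _ _ (h1 k k0) (h2 k k0).
exists d => // p p1 p2; have [/= q1 q2] := hd p p1 p2.
have -> : c1 * G1 p + c2 * G2 p + c - (c1 * G1 0 + c2 * G2 0 + c) - (c1 * A1 + c2 * A2) * p.1
   - (c1 * B1 + c2 * B2) * p.2 =
  c1 * (G1 p - G1 0 - A1 * p.1 - B1 * p.2) + c2 * (G2 p - G2 0 - A2 * p.1 - B2 * p.2) by ring.
apply: le_trans (ler_normD _ _) _; rewrite !normrM.
apply: (@le_trans _ _ (`|c1| * (k * (`|p.1| + `|p.2|)) + `|c2| * (k * (`|p.1| + `|p.2|)))).
  by apply: lerD; apply: ler_wpM2l.
rewrite -mulrDl mulrA; apply: ler_wpM2r; first exact: addr_ge0.
by rewrite /k mulrCA -[leRHS]mulr1; apply: ler_wpM2l;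
  [exact: ltW|rewrite ler_pdivrMr ?mul1r ?lerDl].
Qed.

Lemma linear_at0_snd G A B : linear_at0 G A B -> linear_at0 (fun p => G (0, p.2)) 0 B.
Proof.
move=> h e e0; have [d d0 hd] := h e e0; exists d => // p _ p2.
have /= := hd (0, p.2); rewrite normr0 => /(_ d0 p2); rewrite mulr0 mul0r add0r => h'.
by apply: le_trans h' _; rewrite ler_pM2l // lerDr.
Qed.

(** Mean value theorem on the two legs of the path from $0$ to $(0,b)$ to $(a,b)$. *)
Lemma linear_at0_C1 G (Ga Gb : R * R -> R) :
  near0 (fun p => is_derive p.1 (1 : R) (fun a => G (a, p.2)) (Ga p)) ->
  near0 (fun p => is_derive p.2 (1 : R) (fun b => G (p.1, b)) (Gb p)) ->
  (forall e, 0 < e -> near0 (fun p => `|Ga p - Ga 0| <= e)) ->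
  (forall e, 0 < e -> near0 (fun p => `|Gb p - Gb 0| <= e)) ->
  linear_at0 G (Ga 0) (Gb 0).
Proof.
move=> da db ca cb e e0.
have [d d0 hd] := near0_and _ _ (near0_and _ _ da db) (near0_and _ _ (ca e e0) (cb e e0)).
exists d => // -[a b] /= ha hb.
have [y hy|c hc E1] := @mvt_zero R (fun x => G (x, b)) (fun x => Ga (x, b)) a.
  by have [[/= h _] _] := hd (y, b) (le_lt_trans hy ha) hb.
have z0 : `|0 : R| < d by rewrite normr0.
have [y hy|c' hc' E2] := @mvt_zero R (fun x => G (0, x)) (fun x => Gb (0, x)) b.
  by have [[/= _ h] _] := hd (0, y) z0 (le_lt_trans hy hb).
have [_ [/= h1 _]] := hd (c, b) (le_lt_trans hc ha) hb.
have [_ [/= _ h2]] := hd (0, c') z0 (le_lt_trans hc' hb).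
have -> : G (a, b) - G 0 - Ga 0 * a - Gb 0 * b =
   (Ga (c, b) - Ga 0) * a + (Gb (0, c') - Gb 0) * b.
  by rewrite !mulrBl -E1 -E2 -[(0, 0)]/(0 : R * R); ring.
apply: le_trans (ler_normD _ _) _; rewrite !normrM mulrDr.
by apply: lerD; apply: ler_wpM2r.
Qed.

Lemma sum_sqr_critical (g1 g2 a1 a2 : R -> R) (c1 c2 u v x : R) : u < x < v ->
  (forall y, u < y < v -> is_derive y (1 : R) g1 (a1 y) /\ is_derive y (1 : R) g2 (a2 y)) ->
  (forall y, u < y < v ->
     (g1 x - c1) ^+ 2 + (g2 x - c2) ^+ 2 <= (g1 y - c1) ^+ 2 + (g2 y - c2) ^+ 2) ->
  (g1 x - c1) * a1 x + (g2 x - c2) * a2 x = 0.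
Proof.
move=> ux der minx.
have dD y : u < y < v -> is_derive y (1 : R)
    (fun t => (g1 t - c1) * (g1 t - c1) + (g2 t - c2) * (g2 t - c2))
    (2 * ((g1 y - c1) * a1 y + (g2 y - c2) * a2 y)).
  move=> /der [f1 f2].
  have h1 := is_derive_add _ _ _ _ _ f1 (is_derive_cst (- c1) y 1).
  have h2 := is_derive_add _ _ _ _ _ f2 (is_derive_cst (- c2) y 1).
  apply: (is_derive_eq (is_derive_add _ _ _ _ _ (is_derive_mul _ _ _ _ _ h1 h1)
    (is_derive_mul _ _ _ _ _ h2 h2))).
  by rewrite /cst /=; ring.
have uv : u <= v by case/andP: ux => h1 h2; rewrite ltW // (lt_trans h1).
have [_ E] : is_derive x (1 : R)
    (fun t => (g1 t - c1) * (g1 t - c1) + (g2 t - c2) * (g2 t - c2)) 0.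
  apply: (derive1_at_min uv) => [t|//|t]; rewrite in_itv /=; first by move=> /dD [].
  by move=> /minx; rewrite !expr2.
have [_] := dD x ux; rewrite E => /esym/eqP.
by rewrite mulf_eq0 pnatr_eq0 /= => /eqP.
Qed.

(** Cramer's rule: a nonsingular homogeneous system has only the zero solution. *)
Lemma singular_system (a b c d x y : R) : a * d - b * c != 0 ->
  x * a + y * b = 0 -> x * c + y * d = 0 -> x = 0 /\ y = 0.
Proof.
move=> dn e1 e2; split; apply: (mulIf dn); rewrite mul0r.
  transitivity (d * (x * a + y * b) - b * (x * c + y * d)); first by ring.
  by rewrite e1 e2 !mulr0 subr0.
transitivity (a * (x * c + y * d) - c * (x * a + y * b)); first by ring.
by rewrite e1 e2 !mulr0 subr0.
Qed.

(** On a wall, $|u|=l$ would force $x^2\ge\frac{49}{64}l^2$. The bound $l^2/32=2(l/8)^2$ is what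
    [small_sqr] gives at the centre of the box, so a minimizer cannot lie on a wall. *)
Lemma box_interior (l u x y : R) : 0 < l -> `|u| <= l -> `|x - u| <= l / 8 ->
  x ^+ 2 + y ^+ 2 <= l ^+ 2 / 32 -> `|u| < l.
Proof.
move=> l0 hu hx hD; rewrite lt_neqAle hu andbT; apply/negP => /eqP ul.
have x0 : 0 <= x ^+ 2 <= l ^+ 2 / 32 by rewrite sqr_ge0; have := sqr_ge0 y; lra.
have lx : 7 / 8 * l <= `|x|.
  by have := ler_normB x (x - u); rewrite (_ : x - (x - u) = u) ?ul; [lra|ring].
have : (7 / 8 * l) ^+ 2 <= x ^+ 2.
  by rewrite -(real_normK (num_real x)); apply: lerXn2r => //; rewrite nnegrE //; lra.
have -> : (7 / 8 * l) ^+ 2 = 49 / 64 * l ^+ 2 by field.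
have : 0 < l ^+ 2 by rewrite exprn_gt0.
by move: x0; clear; lra.
Qed.

Lemma small_sqr (x l : R) : `|x| <= l / 8 -> x ^+ 2 <= l ^+ 2 / 64.
Proof.
move=> hx; have -> : l ^+ 2 / 64 = (l / 8) ^+ 2 by field.
have x0 := normr_ge0 x; rewrite -(real_normK (num_real x)).
by apply: lerXn2r => //; rewrite nnegrE //; lra.
Qed.

(* The squared distance from [G] to the target [Q r] attains its minimum over a box
   of size proportional to [r] around [r d] in the interior of the box; as the
   Jacobian is nonsingular, its critical points are solutions of [G = Q r]. *)
Lemma local_hit G1 G2 (A1 B1 A2 B2 : R * R -> R) (Q1 Q2 : R -> R) (d1 d2 : R) :
  linear_at0 G1 1 0 -> linear_at0 G2 0 1 -> 0 < d2 ->
  linear_at0 (fun p => Q1 p.2) 0 d1 -> linear_at0 (fun p => Q2 p.2) 0 d2 ->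
  Q1 0 = G1 0 -> Q2 0 = G2 0 ->
  (forall p : R * R, `|p.1| < 1 -> 0 < p.2 < 1 ->
    [/\ is_derive p.1 (1 : R) (fun a => G1 (a, p.2)) (A1 p),
        is_derive p.2 (1 : R) (fun b => G1 (p.1, b)) (B1 p),
        is_derive p.1 (1 : R) (fun a => G2 (a, p.2)) (A2 p),
        is_derive p.2 (1 : R) (fun b => G2 (p.1, b)) (B2 p) &
        A1 p * B2 p - A2 p * B1 p != 0]) ->
  (forall p : R * R, `|p.1| < 1 -> 0 < p.2 < 1 ->
    {for p, continuous G1} /\ {for p, continuous G2}) ->
  exists (p : R * R) (r : R), [/\ `|p.1| < 1, 0 < p.2 < 1, 0 < r < 1,
    G1 p = Q1 r & G2 p = Q2 r].
Proof.
move=> lG1 lG2 d20 lQ1 lQ2 Q10 Q20 der cont.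
(* The box has half-width [l = k * r], half the height [r * d2] of its centre, and so stays in
   $p_2>0$. There $|p_1|+|p_2|\le Cr$, and [e] is chosen so that the expansion errors of $G$ and of
   the target add up to at most $eCr+er=l/8$. *)
pose k := d2 / 2; have k0 : 0 < k by rewrite divr_gt0.
pose C := `|d1| + 2 * d2; have C0 : 0 < C by rewrite ltr_wpDl // mulr_gt0.
pose e := k / (8 * (C + 1)); have e0 : 0 < e.
  by rewrite divr_gt0 // mulr_gt0 // addr_gt0.
have eC : e * C + e = k / 8.
  by rewrite /e; field; rewrite gt_eqF // addr_gt0.
have [d d0 hd] := near0_and _ _ (near0_and _ _ (lG1 e e0) (lG2 e e0))
  (near0_and _ _ (lQ1 e e0) (lQ2 e e0)).
have [r [r0 Crd Cr1 rd r1]] : exists r, [/\ 0 < r, C * r < d, C * r < 1, r < d & r < 1].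
  pose m := Num.min d 1.
  have m0 : 0 < m by rewrite /m lt_min d0 ltr01.
  have [md m1] : m <= d /\ m <= 1 by rewrite /m !ge_min !lexx orbT.
  have C1 : 0 < 2 * (C + 1) by rewrite mulr_gt0 // addr_gt0.
  pose r := m / (2 * (C + 1)); have r0 : 0 < r by rewrite divr_gt0.
  have rC : r * (2 * (C + 1)) = m by rewrite /r divfK // gt_eqF.
  have Crm : C * r < m by rewrite -rC mulrC ltr_pM2l //; move: C0; clear; lra.
  have rm : r < m by rewrite -[X in X < _]mulr1 -rC ltr_pM2l //; move: C0; clear; lra.
  by exists r; split=> //; apply: lt_le_trans; [exact: Crm|exact: md|exact: Crm|exact: m1
    |exact: rm|exact: md|exact: rm|exact: m1].
pose a0 := r * d1; pose b0 := r * d2; pose l := k * r.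
have l0 : 0 < l by rewrite mulr_gt0.
have b0l : b0 = 2 * l by rewrite /b0 /l /k; field.
have Cr : `|a0| + 2 * b0 = C * r.
  by rewrite /a0 /b0 /C normrM (gtr0_norm r0); ring.
pose box := `[a0 - l, a0 + l]%classic `*` `[b0 - l, b0 + l]%classic : set (R * R).
have boxP p : box p <-> `|p.1 - a0| <= l /\ `|p.2 - b0| <= l.
  by rewrite /box /= !in_itv /= !ler_distl.
have box_bd p : box p -> [/\ `|p.1| + `|p.2| <= C * r, `|p.1| < 1 & 0 < p.2 < 1].
  move=> /boxP []; rewrite ler_distl => h1; rewrite ler_distl => h2.
  have p20 : 0 < p.2 by move: h2 b0l l0; clear; lra.
  have h3 : `|p.1| <= `|a0| + l.
    rewrite ler_norml; move: h1 (ler_norm a0) (ler_norm (- a0)); rewrite normrN.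
    by clear; lra.
  have h4 := normr_ge0 a0; rewrite (gtr0_norm p20).
  move: h2 h3 h4 p20 Cr b0l l0 Cr1; clear => *; split; lra.
have box_est p : box p -> `|G1 p - Q1 r - (p.1 - a0)| <= l / 8 /\
                          `|G2 p - Q2 r - (p.2 - b0)| <= l / 8.
  move=> bp; have [hs p1 p2] := box_bd p bp.
  have [p1d p2d] : `|p.1| < d /\ `|p.2| < d.
    move: hs Crd (normr_ge0 p.1) (normr_ge0 p.2); clear => *; split; lra.
  have [[/= g1 g2] _] := hd p p1d p2d.
  have [||_ [/= q1 q2]] := hd (0, r); rewrite ?normr0 ?(gtr0_norm r0) //=.
  move: q1 q2 g1 g2; rewrite -/(0 : R * R) Q10 Q20 normr0 add0r (gtr0_norm r0) mulr0 subr0.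
  rewrite ?mul0r ?mul1r ?subr0 => q1 q2 g1 g2.
  have ee : e * (`|p.1| + `|p.2|) + e * r <= l / 8.
    apply: (@le_trans _ _ (e * (C * r) + e * r)); first by rewrite lerD2r ler_pM2l.
    by rewrite mulrA -mulrDl eC /l mulrAC.
  split; apply: le_trans ee.
    have -> : G1 p - Q1 r - (p.1 - a0) = (G1 p - G1 0 - p.1) - (Q1 r - G1 0 - d1 * r).
      by rewrite /a0; ring.
    by apply: le_trans (ler_normB _ _) _; apply: lerD.
  have -> : G2 p - Q2 r - (p.2 - b0) = (G2 p - G2 0 - p.2) - (Q2 r - G2 0 - d2 * r).
    by rewrite /b0; ring.
  by apply: le_trans (ler_normB _ _) _; apply: lerD.
pose D p := (G1 p - Q1 r) ^+ 2 + (G2 p - Q2 r) ^+ 2.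
have bc : box (a0, b0) by apply/boxP; rewrite /= !subrr normr0 ltW.
have [q] : exists2 q, q \in box & forall p, p \in box -> D q <= D p.
  apply: compact_EVT_min.
  - by exists (a0, b0).
  - by apply: compact_setX; exact: segment_compact.
  - rewrite continuous_subspace_in => p; rewrite inE => bp.
    have [_ p1 p2] := box_bd p bp; have [c1 c2] := cont p p1 p2.
    apply: (@continuous_subspaceT_for _ _ box D p) => //.
    apply: cvgD; rewrite /= expr2; under eq_fun do rewrite expr2;
      by apply: cvgM; apply: cvgB => //; exact: cvg_cst.
rewrite inE => bq minq.
have Dq : D q <= l ^+ 2 / 32.
  apply: le_trans (minq (a0, b0) _) _; first by rewrite inE.
  have [/=] := box_est _ bc; rewrite !subrr !subr0 => /small_sqr h1 /small_sqr h2.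
  by move: h1 h2; rewrite /D; clear; lra.
have [e1 e2] := box_est _ bq; have [h1 h2] := (boxP q).1 bq.
have hq1 := box_interior _ _ _ _ l0 h1 e1 Dq.
have hq2 : `|q.2 - b0| < l.
  by move: Dq; rewrite /D addrC; exact: box_interior.
have [_ q1 q2] := box_bd q bq; have [_ _ _ _ dn] := der q q1 q2.
(* Fermat's criterion on the horizontal line through [q], and then on the vertical one, makes the
   residual a solution of a nonsingular homogeneous system. *)
have E1 : (G1 q - Q1 r) * A1 q + (G2 q - Q2 r) * A2 q = 0.
  have inb t : a0 - l < t < a0 + l -> box (t, q.2).
    by rewrite -ltr_distl => /ltW ht; apply/boxP.
  have := @sum_sqr_critical (fun a => G1 (a, q.2)) (fun a => G2 (a, q.2))
    (fun a => A1 (a, q.2)) (fun a => A2 (a, q.2)) (Q1 r) (Q2 r) (a0 - l) (a0 + l) q.1.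
  rewrite -surjective_pairing => H; apply: H; first by rewrite -ltr_distl; exact: hq1.
  - by move=> t /inb /box_bd [_ t1 t2]; have [] := der (t, q.2) t1 t2.
  - by move=> t /inb bt; apply: minq; rewrite inE.
have E2 : (G1 q - Q1 r) * B1 q + (G2 q - Q2 r) * B2 q = 0.
  have inb t : b0 - l < t < b0 + l -> box (q.1, t).
    by rewrite -ltr_distl => /ltW ht; apply/boxP.
  have := @sum_sqr_critical (fun b => G1 (q.1, b)) (fun b => G2 (q.1, b))
    (fun b => B1 (q.1, b)) (fun b => B2 (q.1, b)) (Q1 r) (Q2 r) (b0 - l) (b0 + l) q.2.
  rewrite -surjective_pairing => H; apply: H; first by rewrite -ltr_distl; exact: hq2.
  - by move=> t /inb /box_bd [_ t1 t2]; have [] := der (q.1, t) t1 t2.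
  - by move=> t /inb bt; apply: minq; rewrite inE.
have [/eqP + /eqP] := singular_system _ _ _ _ _ _ dn E1 E2.
by rewrite !subr_eq0 => /eqP ? /eqP ?; exists q, r; split=> //; rewrite r0.
Qed.

End LinearApproximation.

(** * Coordinates adapted to a face *)

Section FaceCharts.
Context {R : realType}.
Implicit Types (f : face) (g : R * R -> R) (p z : R * R).

(* Coordinates near a face: [p.1] runs along the face, [p.2] is the distance to it. *)
Definition chart f p : R * R :=
  if f.1 then (p.1, face_sgn R f * (1 - p.2)) else (face_sgn R f * (1 - p.2), p.1).

Definition tangent f : R * R := if f.1 then (1, 0) else (0, 1).

Definition d_tan f g z : R := if f.1 then d_xi g z else d_eta g z.

(** The derivative in [p.2]; the minus sign is there because [p.2] increases inwards. *)
Definition d_nor f g z : R :=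
  - face_sgn R f * (if f.1 then d_eta g z else d_xi g z).

Lemma face_sgn_sqr f : face_sgn R f * face_sgn R f = 1.
Proof. by rewrite /face_sgn; case: ifP => _; rewrite ?mulrNN mulr1. Qed.

Lemma norm_face_sgn f : `|face_sgn R f| = 1.
Proof. by rewrite /face_sgn; case: ifP => _; rewrite ?normrN normr1. Qed.

Lemma chart_face f s : chart f (s, 0) = face_pt f s.
Proof. by rewrite /chart /face_pt /= subr0 mulr1. Qed.

Lemma face_pt_ref f (s : R) : -1 <= s <= 1 -> ref_square (face_pt f s).
Proof.
by move=> hs; rewrite /face_pt /ref_square /face_sgn; do 2!case: ifP => _ /=; split; lra.
Qed.

Lemma chart_open f p : `|p.1| < 1 -> 0 < p.2 < 1 -> open_ref_square (chart f p).
Proof.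
rewrite ltr_norml => h1 h2; rewrite /chart /open_ref_square /face_sgn.
by do 2!case: ifP => _ /=; split; lra.
Qed.

Lemma chart0 f : chart f 0 = face_pt f 0.
Proof. exact: chart_face. Qed.

Lemma ball_chart f (q : R * R) (e : R) p : ball q e p -> ball (chart f q) e (chart f p).
Proof.
move=> [h1 h2].
have h3 : `|face_sgn R f * (1 - q.2) - face_sgn R f * (1 - p.2)| < e.
  rewrite -mulrBr normrM norm_face_sgn mul1r (_ : _ - _ = - (q.2 - p.2)) ?normrN //.
  by ring.
by rewrite /chart; case: ifP => _; split; [exact: h1|exact: h3|exact: h3|exact: h1].
Qed.

Lemma chart_continuous f : continuous (chart f).
Proof.
move=> q; apply/cvg_ballP => e e0.
by apply: filterS (nbhsx_ballx q e e0) => p; exact: ball_chart.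
Qed.

Lemma chart_derive_tan f g p :
  derivable g (chart f p) ((1, 0) : R * R) -> derivable g (chart f p) ((0, 1) : R * R) ->
  is_derive p.1 (1 : R) (fun a => g (chart f (a, p.2))) (d_tan f g (chart f p)).
Proof.
move=> h1 h2; have -> : d_tan f g (chart f p) = 1 * 'D_(tangent f) g (chart f p).
  by rewrite mul1r /d_tan /tangent; case: ifP.
apply: is_derive_along.
  by rewrite /tangent; case: ifP => _; [exact: h1|exact: h2].
move=> h; rewrite /chart /tangent; case: ifP => _;
  by apply: injective_projections; rewrite /= /GRing.scale /=; ring.
Qed.

Lemma chart_derive_nor f g p :
  derivable g (chart f p) ((1, 0) : R * R) -> derivable g (chart f p) ((0, 1) : R * R) ->
  is_derive p.2 (1 : R) (fun b => g (chart f (p.1, b))) (d_nor f g (chart f p)).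
Proof.
move=> h1 h2.
have -> : d_nor f g (chart f p) =
    - face_sgn R f * 'D_(if f.1 then (0, 1) else (1, 0) : R * R) g (chart f p).
  by rewrite /d_nor; case: ifP.
apply: is_derive_along; first by case: ifP => _; [exact: h2|exact: h1].
move=> h; rewrite /chart; case: ifP => _;
  by apply: injective_projections; rewrite /= /GRing.scale /=; ring.
Qed.

Definition C1_at g z := [/\ derivable g z ((1, 0) : R * R), derivable g z ((0, 1) : R * R),
  {for z, continuous g}, {for z, continuous (d_xi g)} & {for z, continuous (d_eta g)}].

(** The open set contains the closed square, so derivatives at points of a face are genuine
    two-sided ones. *)
Lemma smooth_C1 g : smooth_on_square g -> exists O : set (R * R),
  [/\ open O, @ref_square R `<=` O & forall z, O z -> C1_at g z].
Proof.
move=> [B [oB sB hB]]; exists B; split=> // z Bz.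
have [c [dx de [cx _] [ce _]]] := hB 1%N.
by split; [apply: dx|apply: de|apply: c|apply: cx|apply: ce].
Qed.

Lemma near0_chart f (P : R * R -> Prop) :
  (\forall z \near chart f 0, P z) -> near0 (fun p => P (chart f p)).
Proof.
move=> /nbhs_ballP [e /= e0 he]; exists e => // p p1 p2.
by apply: he; apply: ball_chart; split; rewrite /ball /= sub0r normrN.
Qed.

Lemma near0_continuous f g (e : R) : {for chart f 0, continuous g} -> 0 < e ->
  near0 (fun p => `|g (chart f p) - g (chart f 0)| <= e).
Proof.
move=> /cvgrPdist_le cg e0; apply: (near0_chart f (fun z => `|g z - g (chart f 0)| <= e)).
by apply: filterS (cg e e0) => z; rewrite distrC.
Qed.

Lemma chart_linear f g : smooth_on_square g ->
  linear_at0 (fun p => g (chart f p)) (d_tan f g (chart f 0)) (d_nor f g (chart f 0)).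
Proof.
move=> /smooth_C1 [B [oO sO hO]].
have O0 : B (chart f 0).
  by apply: sO; rewrite chart0; apply: face_pt_ref; apply/andP; split; [rewrite oppr_le0|].
have nO : near0 (fun p => B (chart f p)).
  by apply: near0_chart; apply: open_nbhs_nbhs.
have [_ _ _ cx ce] := hO _ O0.
apply: linear_at0_C1 (fun p => d_tan f g (chart f p)) (fun p => d_nor f g (chart f p)) _ _ _ _.
- case: nO => d d0 hd; exists d; [exact: d0|move=> p p1 p2].
  by have [dx de _ _ _] := hO _ (hd p p1 p2); exact: chart_derive_tan dx de.
- case: nO => d d0 hd; exists d; [exact: d0|move=> p p1 p2].
  by have [dx de _ _ _] := hO _ (hd p p1 p2); exact: chart_derive_nor dx de.
- by move=> e e0; rewrite /d_tan; case: ifP => _; apply: near0_continuous.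
- move=> e e0.
  have [d d0 hd] : near0 (fun p => `|(if f.1 then d_eta g (chart f p) else d_xi g (chart f p))
      - (if f.1 then d_eta g (chart f 0) else d_xi g (chart f 0))| <= e).
    by case: ifP => _; apply: near0_continuous.
  exists d => // p p1 p2; rewrite /d_nor -mulrBr normrM normrN norm_face_sgn mul1r.
  exact: hd.
Qed.

Lemma chart_C1 f g p : smooth_on_square g -> `|p.1| < 1 -> 0 < p.2 < 1 ->
  [/\ is_derive p.1 (1 : R) (fun a => g (chart f (a, p.2))) (d_tan f g (chart f p)),
      is_derive p.2 (1 : R) (fun b => g (chart f (p.1, b))) (d_nor f g (chart f p)) &
      {for p, continuous (g \o chart f)}].
Proof.
move=> /smooth_C1 [B [_ sO hO]] p1 p2.
have [h1 h2] := chart_open f p p1 p2.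
have [|dx de c _ _] := hO (chart f p).
  by apply: sO; split; [move: h1|move: h2] => /andP [? ?]; rewrite !ltW.
split; [exact: chart_derive_tan dx de|exact: chart_derive_nor dx de|].
by apply: continuous_comp; [exact: chart_continuous|exact: c].
Qed.

End FaceCharts.

(** * Opposite outward normals on a shared face *)

Section Orientation.
Context {R : realType} {Ne : nat} {M : mesh R Ne} {Omega : set (R * R)}.
Hypothesis HM : conforming_mesh M Omega.
Implicit Types (F : 'I_Ne * face) (f : face) (s : R).

(** The determinant of the linear part of [chart f]. *)
Definition face_orient f : R := if f.1 then - face_sgn R f else face_sgn R f.

Definition rev_sign F : R := if face_rev M F then -1 else 1.

Lemma nbr_paramE F s : nbr_param M F s = rev_sign F * s.
Proof. by rewrite /nbr_param /rev_sign; case: ifP; rewrite ?mulN1r ?mul1r. Qed.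

Lemma nbr_param_in F s : -1 <= s <= 1 -> -1 <= nbr_param M F s <= 1.
Proof. by rewrite /nbr_param; case: ifP => _ ?; lra. Qed.

Lemma face_det F z :
  d_tan F.2 (xmap M F.1) z * d_nor F.2 (ymap M F.1) z
  - d_tan F.2 (ymap M F.1) z * d_nor F.2 (xmap M F.1) z = face_orient F.2 * jac M F.1 z.
Proof.
rewrite /d_tan /d_nor /face_orient /jac /x_xi /x_eta /y_xi /y_eta.
by case: ifP => _; ring.
Qed.

(** The scaled outward normal is the tangent turned by a right angle, with sign [face_orient].
    Matching tangents therefore determine the neighbour's normal up to sign. *)
Lemma outward_vec F z :
  (face_sgn R F.2 * (face_vec M F z).1, face_sgn R F.2 * (face_vec M F z).2) =
  (face_orient F.2 * d_tan F.2 (ymap M F.1) z, - face_orient F.2 * d_tan F.2 (xmap M F.1) z).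
Proof.
rewrite /face_vec /d_tan /face_orient /x_xi /x_eta /y_xi /y_eta.
by case: ifP => _; congr pair; rewrite /=; ring.
Qed.

Lemma face_tangent (g g' : R * R -> R) f f' (r c s : R) :
  smooth_on_square g -> smooth_on_square g' -> r = 1 \/ r = -1 -> -1 <= s <= 1 ->
  (forall s, -1 <= s <= 1 -> g' (face_pt f' (r * s)) = g (face_pt f s) + c) ->
  r * d_tan f' g' (face_pt f' (r * s)) = d_tan f g (face_pt f s).
Proof.
move=> /smooth_C1 [B [_ sO hO]] /smooth_C1 [B' [_ sO' hO']] hr hs E.
have hrs : -1 <= r * s <= 1 by case: hr => ->; lra.
have [dx de _ _ _] := hO _ (sO _ (face_pt_ref f s hs)).
have [dx' de' _ _ _] := hO' _ (sO' _ (face_pt_ref f' (r * s) hrs)).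
have tE (h : face) (k : R * R -> R) z : d_tan h k z = 'D_(tangent h) k z.
  by rewrite /d_tan /tangent; case: ifP.
have tD (h : face) (k : R * R -> R) z :
    derivable k z ((1, 0) : R * R) -> derivable k z ((0, 1) : R * R) ->
    derivable k z (tangent h).
  by move=> k1 k2; rewrite /tangent; case: ifP => _; [exact: k1|exact: k2].
have h1 : is_derive s (1 : R) (fun h => g (face_pt f h)) (1 * d_tan f g (face_pt f s)).
  rewrite tE; refine (is_derive_along g (face_pt f s) (tangent f) 1 s (face_pt f)
    (tD _ _ _ dx de) _).
  move=> h; rewrite /face_pt /tangent; case: ifP => _;
    by apply: injective_projections; rewrite /= /GRing.scale /=; ring.
have h2 : is_derive s (1 : R) (fun h => g' (face_pt f' (r * h)))
    (r * d_tan f' g' (face_pt f' (r * s))).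
  rewrite tE; refine (is_derive_along g' (face_pt f' (r * s)) (tangent f') r s
    (fun h => face_pt f' (r * h)) (tD _ _ _ dx' de') _).
  move=> h; rewrite /face_pt /tangent; case: ifP => _;
    by apply: injective_projections; rewrite /= /GRing.scale /=; ring.
have := is_derive_cst_segment _ _ _ c hs _
  (is_derive_add _ _ _ _ _ h2 (is_derive_scal (-1) _ _ _ h1)).
rewrite mul1r mulN1r => /(_ _)/eqP; rewrite subr_eq0 => H; apply/eqP; apply: H.
by move=> x hx; rewrite E //; ring.
Qed.

Lemma rev_signP F : rev_sign F = 1 \/ rev_sign F = -1.
Proof. by rewrite /rev_sign; case: ifP; [right|left]. Qed.

Lemma nbr_curve_xy F s : -1 <= s <= 1 ->
  xmap M (nbr M F).1 (face_pt (nbr M F).2 (rev_sign F * s)) =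
    xmap M F.1 (face_pt F.2 s) + (face_shift M F).1 /\
  ymap M (nbr M F).1 (face_pt (nbr M F).2 (rev_sign F * s)) =
    ymap M F.1 (face_pt F.2 s) + (face_shift M F).2.
Proof.
move=> hs; have := nbr_curve HM F hs; rewrite nbr_paramE /face_curve /emap.
by move=> [-> ->].
Qed.

Lemma nbr_tangent F s : -1 <= s <= 1 ->
  rev_sign F * d_tan (nbr M F).2 (xmap M (nbr M F).1) (face_pt (nbr M F).2 (rev_sign F * s))
    = d_tan F.2 (xmap M F.1) (face_pt F.2 s) /\
  rev_sign F * d_tan (nbr M F).2 (ymap M (nbr M F).1) (face_pt (nbr M F).2 (rev_sign F * s))
    = d_tan F.2 (ymap M F.1) (face_pt F.2 s).
Proof.
move=> hs; split.
  apply: face_tangent (face_shift M F).1 _ (mesh_smooth_x HM _) (mesh_smooth_x HM _)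
    (rev_signP F) hs _ => x hx.
  by have [] := nbr_curve_xy F x hx.
apply: face_tangent (face_shift M F).2 _ (mesh_smooth_y HM _) (mesh_smooth_y HM _)
  (rev_signP F) hs _ => x hx.
by have [] := nbr_curve_xy F x hx.
Qed.

(* Were both elements on the same side of the shared face, they would overlap near
   its midpoint. *)
Lemma nbr_orient F : face_orient (nbr M F).2 * rev_sign F = - face_orient F.2.
Proof.
have oP f : face_orient f = 1 \/ face_orient f = -1.
  by rewrite /face_orient /face_sgn; do 2!case: ifP => _; rewrite ?opprK; tauto.
have [//|E] : face_orient (nbr M F).2 * rev_sign F = - face_orient F.2 \/
              face_orient (nbr M F).2 * rev_sign F = face_orient F.2.
  by case: (oP F.2) (oP (nbr M F).2) (rev_signP F) => -> [] -> [] ->;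
    rewrite ?mulr1 ?mulrN1 ?opprK; tauto.
exfalso.
set F' := nbr M F in E; set sg := face_shift M F.
have hs0 : -1 <= (0 : R) <= 1 by apply/andP; split; [rewrite oppr_le0|].
have [X0 Y0] := nbr_curve_xy F 0 hs0.
have [TX TY] := nbr_tangent F 0 hs0.
rewrite mulr0 -!chart0 in X0 Y0 TX TY.
have J0 : 0 < jac M F.1 (chart F.2 0).
  by apply: (mesh_jac_gt0 HM); rewrite chart0; apply: face_pt_ref.
have J0' : 0 < jac M F'.1 (chart F'.2 0).
  by apply: (mesh_jac_gt0 HM); rewrite chart0; apply: face_pt_ref.
have det := face_det F (chart F.2 0).
have det' := face_det F' (chart F'.2 0).
have LX := chart_linear F.2 _ (mesh_smooth_x HM F.1).
have LY := chart_linear F.2 _ (mesh_smooth_y HM F.1).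
have LX' := chart_linear F'.2 _ (mesh_smooth_x HM F'.1).
have LY' := chart_linear F'.2 _ (mesh_smooth_y HM F'.1).
move: TX TY det det' LX LY LX' LY'; rewrite -/F'.
set tx := d_tan F.2 (xmap M F.1) _; set ty := d_tan F.2 (ymap M F.1) _.
set nx := d_nor F.2 (xmap M F.1) _; set ny := d_nor F.2 (ymap M F.1) _.
set tx' := d_tan F'.2 (xmap M F'.1) _; set ty' := d_tan F'.2 (ymap M F'.1) _.
set nx' := d_nor F'.2 (xmap M F'.1) _; set ny' := d_nor F'.2 (ymap M F'.1) _.
move=> TX TY det det' LX LY LX' LY'.
set J := jac M F.1 _ in J0 det; set J' := jac M F'.1 _ in J0' det'.
set o := face_orient F.2 in det E; set o' := face_orient F'.2 in det' E.
set s := rev_sign F in TX TY E.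
pose dt := o' * J'.
have o0' : o' != 0 by rewrite /o'; case: (oP F'.2) => ->; rewrite ?oppr_eq0 oner_eq0.
have dt0 : dt != 0 by rewrite mulf_neq0 // gt_eqF.
have s2 : s * s = 1 by rewrite /s; case: (rev_signP F) => ->; rewrite ?mulrNN mulr1.
have dtE : tx' * ny' - ty' * nx' = dt by exact: det'.
(* [G1], [G2] are the neighbour's mapping composed with the inverse of its derivative at the
   midpoint, so that their derivative there is the identity. [H1], [H2] apply the same linear map to
   the shifted mapping of [F.1]. *)
pose G1 := fun p : R * R => (ny' / dt) * xmap M F'.1 (chart F'.2 p)
                          + (- nx' / dt) * ymap M F'.1 (chart F'.2 p) + 0.
pose G2 := fun p : R * R => (- ty' / dt) * xmap M F'.1 (chart F'.2 p)
                          + (tx' / dt) * ymap M F'.1 (chart F'.2 p) + 0.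
pose H1 := fun p : R * R => (ny' / dt) * xmap M F.1 (chart F.2 p)
     + (- nx' / dt) * ymap M F.1 (chart F.2 p) + (ny' / dt * sg.1 - nx' / dt * sg.2).
pose H2 := fun p : R * R => (- ty' / dt) * xmap M F.1 (chart F.2 p)
     + (tx' / dt) * ymap M F.1 (chart F.2 p) + (- ty' / dt * sg.1 + tx' / dt * sg.2).
have lG1 := linear_at0_comb _ _ _ _ _ _ (ny' / dt) (- nx' / dt) 0 LX' LY'.
have lG2 := linear_at0_comb _ _ _ _ _ _ (- ty' / dt) (tx' / dt) 0 LX' LY'.
have lH1 := linear_at0_comb _ _ _ _ _ _ (ny' / dt) (- nx' / dt)
  (ny' / dt * sg.1 - nx' / dt * sg.2) LX LY.
have lH2 := linear_at0_comb _ _ _ _ _ _ (- ty' / dt) (tx' / dt)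
  (- ty' / dt * sg.1 + tx' / dt * sg.2) LX LY.
(* In the neighbour's coordinates the inward direction of [F] has second component [J / J']: under
   [E] the orientation signs cancel. This is where the wrong sign places both elements on one
   side. *)
have d20 : 0 < - ty' / dt * nx + tx' / dt * ny.
  have e1 : tx' = s * tx by rewrite -TX mulrA s2 mul1r.
  have e2 : ty' = s * ty by rewrite -TY mulrA s2 mul1r.
  have -> : - ty' / dt * nx + tx' / dt * ny = s * (tx * ny - ty * nx) / dt.
    by rewrite e1 e2; ring.
  have so : s * o = o' by rewrite -E mulrCA s2 mulr1.
  rewrite det mulrA so /dt.
  by rewrite -mulf_div divff // mul1r divr_gt0.
have c1 : ny' / dt * tx' + - nx' / dt * ty' = 1 by rewrite -[RHS](divff dt0) -dtE; ring.
have c2 : ny' / dt * nx' + - nx' / dt * ny' = 0 by ring.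
have c3 : - ty' / dt * tx' + tx' / dt * ty' = 0 by ring.
have c4 : - ty' / dt * nx' + tx' / dt * ny' = 1 by rewrite -[RHS](divff dt0) -dtE; ring.
rewrite c1 c2 in lG1; rewrite c3 c4 in lG2.
clearbody dt.
pose T (g : R * R -> R) p := d_tan F'.2 g (chart F'.2 p).
pose N (g : R * R -> R) p := d_nor F'.2 g (chart F'.2 p).
pose x' := xmap M F'.1; pose y' := ymap M F'.1.
(* The target is the straight inward path [(0, r)] from the midpoint of [F]; hitting it gives a
   point interior to both elements. *)
have [] := local_hit G1 G2
  (fun p => ny' / dt * T x' p + - nx' / dt * T y' p)
  (fun p => ny' / dt * N x' p + - nx' / dt * N y' p)
  (fun p => - ty' / dt * T x' p + tx' / dt * T y' p)
  (fun p => - ty' / dt * N x' p + tx' / dt * N y' p)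
  (fun r => H1 (0, r)) (fun r => H2 (0, r)) _ _ lG1 lG2 d20
  (linear_at0_snd _ _ _ lH1) (linear_at0_snd _ _ _ lH2).
- by rewrite /H1 /G1 -/(0 : R * R) X0 Y0; ring.
- by rewrite /H2 /G2 -/(0 : R * R) X0 Y0; ring.
- move=> p p1 p2.
  have [a1 a2 _] := chart_C1 F'.2 _ p (mesh_smooth_x HM F'.1) p1 p2.
  have [b1 b2 _] := chart_C1 F'.2 _ p (mesh_smooth_y HM F'.1) p1 p2.
  have comb (u v : R -> R) (t du dv k1 k2 : R) : is_derive t (1 : R) u du ->
      is_derive t (1 : R) v dv ->
      is_derive t (1 : R) (fun z => k1 * u z + k2 * v z + 0) (k1 * du + k2 * dv).
    move=> hu hv; apply: (is_derive_eq (is_derive_add _ _ _ _ _ (is_derive_add _ _ _ _ _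
      (is_derive_scal k1 _ _ _ hu) (is_derive_scal k2 _ _ _ hv)) (is_derive_cst (0 : R) t 1))).
    by rewrite addr0.
  split; [exact: comb a1 b1|exact: comb a2 b2|exact: comb a1 b1|exact: comb a2 b2|].
  have := face_det F' (chart F'.2 p); rewrite -/x' -/y' -/(T x' p) -/(T y' p) -/(N x' p) -/(N y' p).
  have Jp : 0 < jac M F'.1 (chart F'.2 p).
    have [h1 h2] := chart_open F'.2 p p1 p2; apply: (mesh_jac_gt0 HM).
    by split; [move: h1|move: h2] => /andP [? ?]; rewrite !ltW.
  move=> dp; have -> : (ny' / dt * T x' p + - nx' / dt * T y' p) *
      (- ty' / dt * N x' p + tx' / dt * N y' p) -
      (- ty' / dt * T x' p + tx' / dt * T y' p) *
      (ny' / dt * N x' p + - nx' / dt * N y' p) =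
      (tx' * ny' - ty' * nx') * (T x' p * N y' p - T y' p * N x' p) / dt ^+ 2 by field.
  by rewrite dp dtE !mulf_neq0 ?invr_eq0 ?expf_neq0 // gt_eqF.
- move=> p p1 p2.
  have [_ _ a] := chart_C1 F'.2 _ p (mesh_smooth_x HM F'.1) p1 p2.
  have [_ _ b] := chart_C1 F'.2 _ p (mesh_smooth_y HM F'.1) p1 p2.
  have comb (k1 k2 : R) : {for p, continuous (fun z => k1 * x' (chart F'.2 z) +
      k2 * y' (chart F'.2 z) + 0)}.
    by apply: cvgD; [apply: cvgD; apply: cvgM; [exact: cvg_cst|exact: a|exact: cvg_cst|exact: b]
                    |exact: cvg_cst].
  by split; exact: comb.
move=> p [r [p1 p2 r01 e1 e2]].
apply: (@nbr_disjoint _ _ _ _ HM F (chart F.2 (0, r)) (chart F'.2 p)).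
- by apply: chart_open; rewrite // normr0.
- exact: chart_open.
move: e1 e2; rewrite /G1 /G2 /H1 /H2 /emap -/F' -/sg -/x' -/y'.
move: (x' _) (y' _) (xmap M F.1 _) (ymap M F.1 _) => X Y x y e1 e2.
(* Undoes the linear normalization: equal normalized values mean equal physical points up to the
   shift. *)
have [] := @singular_system _ (ny' / dt) (- nx' / dt) (- ty' / dt) (tx' / dt)
  (X - x - sg.1) (Y - y - sg.2).
- have -> : ny' / dt * (tx' / dt) - - nx' / dt * (- ty' / dt) =
    (tx' * ny' - ty' * nx') / dt ^+ 2 by field.
  by rewrite dtE mulf_neq0 // invr_eq0 expf_neq0.
- by move: e1; clear; lra.
- by move: e2; clear; lra.
move=> hx hy; apply: injective_projections => /=.
  by apply/eqP; rewrite -subr_eq0 opprD addrA hx.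
by apply/eqP; rewrite -subr_eq0 opprD addrA hy.
Qed.

(** Otherwise, crossing the face and returning would give $s\to-s$ on [F] up to a translation.
    Taking $s=0$ shows that the translation is zero, and $s=1$ then contradicts injectivity. *)
Lemma face_rev_nbr F : face_rev M (nbr M F) = face_rev M F.
Proof.
have E s : -1 <= s <= 1 ->
    face_curve M F (nbr_param M (nbr M F) (nbr_param M F s)) =
    face_curve M F s + (face_shift M F + face_shift M (nbr M F)).
  move=> hs; have := nbr_curve HM (nbr M F) (nbr_param_in F s hs).
  by rewrite (nbr_invol HM) => ->; rewrite (nbr_curve HM F hs) addrA.
apply/eqP; apply: contraT => ne.
have pE s : nbr_param M (nbr M F) (nbr_param M F s) = - s.
  by move: ne; rewrite /nbr_param; do 2!case: (face_rev M _) => //; rewrite opprK.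
have s0 : -1 <= (0 : R) <= 1 by apply/andP; split; [rewrite oppr_le0|].
have := E 0 s0; rewrite pE oppr0 -[LHS]addr0 => /addrI c0.
have s1 : -1 <= (1 : R) <= 1 by apply/andP; split; [apply: (@le_trans _ _ 0); rewrite ?oppr_le0|].
have s1' : -1 <= (-1 : R) <= 1 by apply/andP; split; [|apply: (@le_trans _ _ 0); rewrite ?oppr_le0].
have := E 1 s1; rewrite pE -c0 addr0.
move=> /(mesh_injective HM (face_pt_ref _ _ s1') (face_pt_ref _ _ s1)).
have n11 : (-1 : R) <> 1 by move=> h; have : (0 : R) < 1 := ltr01; lra.
by rewrite /face_pt; case: ifP => _ []; tauto.
Qed.

Lemma nbr_paramK F s : nbr_param M (nbr M F) (nbr_param M F s) = s.
Proof. by rewrite /nbr_param face_rev_nbr; case: (face_rev M F); rewrite ?opprK. Qed.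

Definition scaled_normal F s : R * R :=
  (face_sgn R F.2 * (face_vec M F (face_pt F.2 s)).1,
   face_sgn R F.2 * (face_vec M F (face_pt F.2 s)).2).

Lemma scaled_normal_nbr F s : -1 <= s <= 1 ->
  scaled_normal (nbr M F) (nbr_param M F s) =
  (- (scaled_normal F s).1, - (scaled_normal F s).2).
Proof.
move=> hs; rewrite /scaled_normal !outward_vec nbr_paramE /=.
have [<- <-] := nbr_tangent F s hs; have := nbr_orient F.
move: (d_tan (nbr M F).2 _ _) (d_tan (nbr M F).2 _ _) => a b.
have s2 : rev_sign F * rev_sign F = 1.
  by case: (rev_signP F) => ->; rewrite ?mulrNN mulr1.
move=> h; have {}h : face_orient F.2 = - (face_orient (nbr M F).2 * rev_sign F).
  by rewrite h opprK.
rewrite h; congr pair.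
  by rewrite mulNr opprK -mulrA [rev_sign F * (_ * _)]mulrA s2 mul1r.
by rewrite !opprK mulNr; congr (- _); rewrite -mulrA [rev_sign F * (_ * _)]mulrA s2 mul1r.
Qed.

Lemma norm2_scaled F s : norm2 (scaled_normal F s) = norm2 (face_vec M F (face_pt F.2 s)).
Proof. by rewrite /norm2 /= !exprMn ![face_sgn R _ ^+ 2]expr2 face_sgn_sqr !mul1r. Qed.

Lemma outward_normalE F s : outward_normal M F s =
  ((scaled_normal F s).1 / norm2 (scaled_normal F s),
   (scaled_normal F s).2 / norm2 (scaled_normal F s)).
Proof. by rewrite norm2_scaled. Qed.

Lemma norm2N (a : R * R) : norm2 (- a.1, - a.2) = norm2 a.
Proof. by rewrite /norm2 /= !sqrrN. Qed.

Lemma norm2_ge0 (a : R * R) : 0 <= norm2 a.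
Proof. exact: sqrtr_ge0. Qed.

(* Also at [a = 0], where both sides vanish. *)
Lemma norm2_unit (a : R * R) : (norm2 a * (a.1 / norm2 a), norm2 a * (a.2 / norm2 a)) = a.
Proof.
have [n0|n0] := eqVneq (norm2 a) 0; last by rewrite ![norm2 a * _]mulrC !divfK //; case: a n0.
have : a.1 ^+ 2 + a.2 ^+ 2 == 0.
  by rewrite eq_le addr_ge0 ?sqr_ge0 // andbT -sqrtr_eq0 -/(norm2 a) n0.
rewrite paddr_eq0 ?sqr_ge0 // !sqrf_eq0 n0 !mul0r.
by case: a n0 => a b /= _ /andP [/eqP -> /eqP ->].
Qed.

Lemma outward_normal_nbr F s : -1 <= s <= 1 ->
  outward_normal M (nbr M F) (nbr_param M F s) =
  (- (outward_normal M F s).1, - (outward_normal M F s).2).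
Proof.
by move=> hs; rewrite !outward_normalE scaled_normal_nbr // norm2N /= !mulNr.
Qed.

End Orientation.

(** * Entropy balance *)

Lemma sum_pair (R : nmodType) (I J : finType) (G : I * J -> R) :
  \sum_p G p = \sum_i \sum_j G (i, j).
Proof. by rewrite pair_bigA; apply: eq_bigr => -[]. Qed.

(** * Summation by parts along one grid line *)

Section SummationByParts.
Context {R : realType} {N : nat} {xi : 'I_N.+1 -> R}.
Hypothesis xiP : is_LGL xi.
Hypothesis N1 : (1 <= N)%N.
Local Notation w := (lgl_weight xi).
Local Notation D := (dmat xi).

Lemma sbp_swap (G : 'I_N.+1 -> 'I_N.+1 -> R) :
  \sum_p \sum_i w p * D p i * G i p =
  G ord_max ord_max - G ord0 ord0 - \sum_p \sum_i w p * D p i * G p i.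
Proof.
apply/eqP; rewrite -subr_eq opprK; apply/eqP.
rewrite [X in X + _]exchange_big -big_split /=.
transitivity (\sum_p \sum_i (((p == ord_max) && (i == ord_max))%:R
    - ((p == ord0) && (i == ord0))%:R) * G p i).
  apply: eq_bigr => p _; rewrite -big_split /=; apply: eq_bigr => i _.
  by rewrite -(lgl_sbp xiP N1) mulrDl addrC.
have pt o : \sum_p \sum_i ((p == o) && (i == o))%:R * G p i = G o o.
  rewrite (bigD1 o) //= (bigD1 o) //= !eqxx mul1r big1 => [|i /negbTE ->]; last by rewrite mul0r.
  by rewrite addr0 big1 ?addr0 // => p /negbTE pe; rewrite big1 // => i _; rewrite pe mul0r.
rewrite -(pt ord_max) -(pt ord0) -sumrB; apply: eq_bigr => p _.
by rewrite -sumrB; apply: eq_bigr => i _; rewrite mulrBl.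
Qed.

(** The average times the difference expands into four sums: the one in $a_p\psi_p$ vanishes since
    the rows of $D$ sum to zero, the one in $a_i\psi_p$ is kept, and [sbp_swap] rewrites the other
    two. *)
Lemma split_form (a psi : 'I_N.+1 -> R) :
  \sum_p \sum_i w p * D p i * (avg (a i) (a p) * (psi p - psi i)) =
  \sum_p w p * psi p * (\sum_i D p i * a i)
  - (a ord_max * psi ord_max - a ord0 * psi ord0).
Proof.
have h3 : \sum_p \sum_i w p * D p i * (a p * psi p) = 0.
  by rewrite big1 // => p _; rewrite -mulr_suml -mulr_sumr dmat_row_sum // mulr0 mul0r.
have h2 := sbp_swap (fun i p => a i * psi i).
have h4 := sbp_swap (fun i p => a p * psi i).
have h1 : \sum_p \sum_i w p * D p i * (a i * psi p) =
    \sum_p w p * psi p * (\sum_i D p i * a i).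
  by apply: eq_bigr => p _; rewrite mulr_sumr; apply: eq_bigr => i _; ring.
rewrite -h1; rewrite h3 subr0 /= in h2; rewrite /= in h4.
transitivity (2^-1 * (\sum_p \sum_i w p * D p i * (a i * psi p)
   - \sum_p \sum_i w p * D p i * (a i * psi i)
   + \sum_p \sum_i w p * D p i * (a p * psi p)
   - \sum_p \sum_i w p * D p i * (a p * psi i))).
  rewrite -sumrB -big_split /= -sumrB mulr_sumr; apply: eq_bigr => p _.
  rewrite -sumrB -big_split /= -sumrB mulr_sumr; apply: eq_bigr => i _.
  by rewrite /avg; field.
by rewrite h3 h2 h4; field.
Qed.

Variables (a b : 'I_N.+1 -> R) (V : 'I_N.+1 -> 'rV[R]_4).
Hypothesis admV : forall i, admissible (V i).

Definition dot_flux p (h : 'I_4 -> R) := \sum_k evar (V p) 0 k * h k.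

Definition volume_flux i p k : R :=
  avg (a i) (a p) * fsharp (V i) (V p) 0 k - avg (b i) (b p) * gsharp (V i) (V p) 0 k.

Definition normal_potential p : R := a p * psi_f (V p) - b p * psi_g (V p).

Definition normal_flux p k : R := a p * flux_f (V p) 0 k - b p * flux_g (V p) 0 k.

Lemma volume_fluxC i p k : volume_flux i p k = volume_flux p i k.
Proof.
by rewrite /volume_flux [avg (a i) _]avgC [avg (b i) _]avgC fsharpC gsharpC.
Qed.

Lemma volume_fluxxx p k : volume_flux p p k = normal_flux p k.
Proof. by rewrite /volume_flux !avgxx fsharpxx // gsharpxx. Qed.

Lemma volume_jump i p : dot_flux p (volume_flux i p) - dot_flux i (volume_flux p i) =
  avg (a i) (a p) * (psi_f (V p) - psi_f (V i))
  - avg (b i) (b p) * (psi_g (V p) - psi_g (V i)).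
Proof.
rewrite -!tadmor_fsharp // -tadmor_gsharp // !mulr_sumr -!sumrB.
apply: eq_bigr => k _; rewrite (volume_fluxC p i) /volume_flux.
by rewrite (fsharpC (V p)) (gsharpC (V p)); ring.
Qed.

(** One of the two copies of the sum is transposed by [sbp_swap]. This leaves corner terms, where
    the flux is consistent, and a sum of differences that [volume_jump] turns into potential jumps,
    ready for [split_form]. *)
Lemma line_identity :
  \sum_p w p * (2 * \sum_i D p i * dot_flux p (volume_flux i p)) =
  \sum_p w p * (psi_f (V p) * (\sum_i D p i * a i) - psi_g (V p) * (\sum_i D p i * b i))
  + (dot_flux ord_max (normal_flux ord_max) - normal_potential ord_max)
  - (dot_flux ord0 (normal_flux ord0) - normal_potential ord0).
Proof.
pose T i p := dot_flux p (volume_flux i p).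
have TE p : T p p = dot_flux p (normal_flux p).
  by apply: eq_bigr => k _; rewrite volume_fluxxx.
have sw := sbp_swap T; have Tj := volume_jump.
have E : \sum_p w p * (2 * \sum_i D p i * T i p) =
    2 * \sum_p \sum_i w p * D p i * T i p.
  rewrite [RHS]mulr_sumr; apply: eq_bigr => p _; rewrite mulrCA.
  by congr (2 * _); rewrite mulr_sumr; apply: eq_bigr => i _; rewrite mulrA.
rewrite E; have E2 : \sum_p \sum_i w p * D p i * T i p - \sum_p \sum_i w p * D p i * T p i =
    \sum_p \sum_i w p * D p i * (avg (a i) (a p) * (psi_f (V p) - psi_f (V i)))
    - \sum_p \sum_i w p * D p i * (avg (b i) (b p) * (psi_g (V p) - psi_g (V i))).
  rewrite -!sumrB; apply: eq_bigr => p _; rewrite -!sumrB; apply: eq_bigr => i _.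
  by rewrite -!mulrBr -Tj.
rewrite !split_form in E2.
have -> : \sum_p w p * (psi_f (V p) * (\sum_i D p i * a i) - psi_g (V p) * (\sum_i D p i * b i))
  = \sum_p w p * psi_f (V p) * (\sum_i D p i * a i)
    - \sum_p w p * psi_g (V p) * (\sum_i D p i * b i).
  by rewrite -sumrB; apply: eq_bigr => p _; ring.
rewrite -!TE /normal_potential; move: sw E2.
move: (\sum_p \sum_i w p * D p i * T i p) (\sum_p \sum_i w p * D p i * T p i).
by move=> S1 S2 e1 e2; rewrite mulr2n mulrDl mul1r {2}e1 addrCA addrC e2; ring.
Qed.

End SummationByParts.

(** * Entropy balance on one element *)

Section ElementBalance.
Context {R : realType} {N Ne : nat} {xi : 'I_N.+1 -> R} {M : mesh R Ne}.
Context {W : 'I_Ne -> R * R -> 'rV[R]_4}.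
Hypothesis xiP : is_LGL xi.
Hypothesis N1 : (1 <= N)%N.
Hypothesis metricP : metric_identities xi M.
Hypothesis admW : forall e p1 p2, admissible (W e (node xi p1 p2)).
Local Notation w := (lgl_weight xi).
Local Notation D := (dmat xi).
Local Notation nd := (node xi).
Implicit Types (e : 'I_Ne) (F : 'I_Ne * face) (q : 'I_N.+1).

Definition face_flux F q : R :=
  dot2 (psi_f (trace_in W F (xi q)), psi_g (trace_in W F (xi q))) (scaled_normal F (xi q) (M := M))
  - norm2 (face_vec M F (face_pt F.2 (xi q))) *
    \sum_k evar (trace_in W F (xi q)) 0 k *
      lf_flux (outward_normal M F (xi q)) (trace_in W F (xi q)) (trace_out M W F (xi q)) 0 k.

Lemma face_fluxE e f q : face_flux (e, f) q = face_sgn R f *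
  (dot2 (psi_f (W e (face_pt f (xi q))), psi_g (W e (face_pt f (xi q))))
        (face_vec M (e, f) (face_pt f (xi q)))
   - \sum_k evar (W e (face_pt f (xi q))) 0 k * interface_flux xi M W e f k q).
Proof.
rewrite mulrBr; congr (_ - _); first by rewrite /dot2 /scaled_normal /=; ring.
rewrite !mulr_sumr; apply: eq_bigr => k _; rewrite /interface_flux /trace_in /=.
set L := lf_flux _ _ _ _ _; set n := norm2 _.
transitivity ((face_sgn R f * face_sgn R f) * (n * (evar (W e (face_pt f (xi q))) 0 k * L))).
  by rewrite face_sgn_sqr mul1r.
by ring.
Qed.

Lemma sum_delta (G : 'I_N.+1 -> R) o : \sum_p G p * (p == o)%:R = G o.
Proof.
rewrite (bigD1 o) //= eqxx mulr1 big1 ?addr0 // => p /negbTE ->.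
by rewrite mulr0.
Qed.

Lemma element_balance e (dU : 'I_4 -> 'I_N.+1 -> 'I_N.+1 -> R) :
  (forall k p1 p2, dgsem_residual xi M W e k p1 p2 (dU k p1 p2) = 0) ->
  \sum_p1 \sum_p2 w p1 * w p2 * jac M e (nd p1 p2) *
     \sum_k evar (W e (nd p1 p2)) 0 k * dU k p1 p2 =
  \sum_(f : bool * bool) \sum_q w q * face_flux (e, f) q.
Proof.
move=> res; case: (xiP) => _ x0 xN _.
pose dotV p1 p2 (h : 'I_4 -> R) := \sum_k evar (W e (nd p1 p2)) 0 k * h k.
have dotV_sum p1 p2 c (h : 'I_N.+1 -> 'I_4 -> R) :
    dotV p1 p2 (fun k => \sum_i c i * h i k) = \sum_i c i * dotV p1 p2 (h i).
  rewrite /dotV; under eq_bigr => k _ do rewrite mulr_sumr.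
  rewrite exchange_big; apply: eq_bigr => i _; rewrite mulr_sumr.
  by apply: eq_bigr => k _; rewrite mulrCA.
(* [X1] is the time term, [X2] and [X3] are the volume terms in the $\xi$ and $\eta$ directions; the
   sums in [X2] are ordered so that each inner one runs along a grid line. *)
pose X1 := \sum_p1 \sum_p2 w p1 * w p2 * jac M e (nd p1 p2) * dotV p1 p2 (fun k => dU k p1 p2).
pose X2 := \sum_p2 w p2 * \sum_p1 w p1 * (2 * \sum_i D p1 i * dotV p1 p2
   (fun k => ftilde_sharp xi M W e k i p1 p2)).
pose X3 := \sum_p1 w p1 * \sum_p2 w p2 * (2 * \sum_j D p2 j * dotV p1 p2
   (fun k => gtilde_sharp xi M W e k p1 j p2)).
pose g0 p := dotV p ord0
  (fun k => gtilde xi M W e k p ord0 - interface_flux xi M W e eta_minus k p).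
pose gN p := dotV p ord_max
  (fun k => gtilde xi M W e k p ord_max - interface_flux xi M W e eta_plus k p).
pose f0 p := dotV ord0 p
  (fun k => ftilde xi M W e k ord0 p - interface_flux xi M W e xi_minus k p).
pose fN p := dotV ord_max p
  (fun k => ftilde xi M W e k ord_max p - interface_flux xi M W e xi_plus k p).
have balance : X1 + X2 + X3 + \sum_p w p * (g0 p - gN p) + \sum_p w p * (f0 p - fN p) = 0.
  pose g p1 p2 o f := dotV p1 p2 (fun k => gtilde xi M W e k p1 o - interface_flux xi M W e f k p1).
  pose f p1 p2 o f := dotV p1 p2 (fun k => ftilde xi M W e k o p2 - interface_flux xi M W e f k p2).
  transitivity (\sum_p1 \sum_p2 dotV p1 p2 (fun k => dgsem_residual xi M W e k p1 p2 (dU k p1 p2)));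
    last first.
    rewrite big1 // => p1 _; rewrite big1 // => p2 _; rewrite /dotV big1 // => k _.
    by rewrite res mulr0.
  have E p1 p2 : dotV p1 p2 (fun k => dgsem_residual xi M W e k p1 p2 (dU k p1 p2)) =
      w p1 * w p2 * jac M e (nd p1 p2) * dotV p1 p2 (fun k => dU k p1 p2)
      + w p2 * (w p1 * (2 * \sum_i D p1 i * dotV p1 p2 (fun k => ftilde_sharp xi M W e k i p1 p2)))
      + w p1 * (w p2 * (2 * \sum_j D p2 j * dotV p1 p2 (fun k => gtilde_sharp xi M W e k p1 j p2)))
      + w p1 * (g p1 p2 ord0 eta_minus * (p2 == ord0)%:R
                - g p1 p2 ord_max eta_plus * (p2 == ord_max)%:R)
      + w p2 * (f p1 p2 ord0 xi_minus * (p1 == ord0)%:R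
                - f p1 p2 ord_max xi_plus * (p1 == ord_max)%:R).
    rewrite -!dotV_sum /g /f /dotV !(mulr_suml, mulr_sumr) -!sumrB !mulr_sumr -!big_split /=.
    by apply: eq_bigr => k _; rewrite /dgsem_residual; ring.
  under [RHS]eq_bigr => p1 _ do under eq_bigr => p2 _ do rewrite E.
  under [RHS]eq_bigr => p1 _ do rewrite !big_split /=.
  rewrite !big_split /=; congr (_ + _ + _ + _ + _).
  - rewrite /X2 [RHS]exchange_big /=; apply: eq_bigr => p2 _.
    by rewrite mulr_sumr.
  - by apply: eq_bigr => p1 _; rewrite mulr_sumr.
  - by apply: eq_bigr => p1 _; rewrite -mulr_sumr sumrB !sum_delta.
  - rewrite [RHS]exchange_big /=; apply: eq_bigr => p2 _.
    rewrite -mulr_sumr sumrB.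
    by rewrite (sum_delta (fun p => f p p2 ord0 xi_minus))
      (sum_delta (fun p => f p p2 ord_max xi_plus)).
have X2E : X2 = \sum_p2 w p2 * (\sum_p1 w p1 *
      (psi_f (W e (nd p1 p2)) * (\sum_i D p1 i * y_eta M e (nd i p2))
       - psi_g (W e (nd p1 p2)) * (\sum_i D p1 i * x_eta M e (nd i p2)))
   + (dotV ord_max p2 (fun k => ftilde xi M W e k ord_max p2)
      - (y_eta M e (nd ord_max p2) * psi_f (W e (nd ord_max p2))
         - x_eta M e (nd ord_max p2) * psi_g (W e (nd ord_max p2))))
   - (dotV ord0 p2 (fun k => ftilde xi M W e k ord0 p2)
      - (y_eta M e (nd ord0 p2) * psi_f (W e (nd ord0 p2))
         - x_eta M e (nd ord0 p2) * psi_g (W e (nd ord0 p2))))).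
  apply: eq_bigr => p2 _; congr (_ * _).
  exact: (line_identity xiP N1 (fun i => y_eta M e (nd i p2)) (fun i => x_eta M e (nd i p2))
    (fun i => W e (nd i p2)) (fun i => admW e i p2)).
(* The signs of $-y_\xi$ and $-x_\xi$ bring $\tilde g$ to the form $af-bg$ of [line_identity]. *)
have X3E : X3 = \sum_p1 w p1 * (\sum_p2 w p2 *
      (psi_f (W e (nd p1 p2)) * (\sum_j D p2 j * - y_xi M e (nd p1 j))
       - psi_g (W e (nd p1 p2)) * (\sum_j D p2 j * - x_xi M e (nd p1 j)))
   + (dotV p1 ord_max (fun k => gtilde xi M W e k p1 ord_max)
      - (- y_xi M e (nd p1 ord_max) * psi_f (W e (nd p1 ord_max))
         - - x_xi M e (nd p1 ord_max) * psi_g (W e (nd p1 ord_max))))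
   - (dotV p1 ord0 (fun k => gtilde xi M W e k p1 ord0)
      - (- y_xi M e (nd p1 ord0) * psi_f (W e (nd p1 ord0))
         - - x_xi M e (nd p1 ord0) * psi_g (W e (nd p1 ord0))))).
  apply: eq_bigr => p1 _; congr (_ * _).
  have gE o : dotV p1 o (fun k => gtilde xi M W e k p1 o) = dot_flux (fun j => W e (nd p1 j)) o
     (normal_flux (fun j => - y_xi M e (nd p1 j)) (fun j => - x_xi M e (nd p1 j))
       (fun j => W e (nd p1 j)) o).
    by apply: eq_bigr => k _; rewrite /gtilde /normal_flux !mulNr opprK.
  rewrite !gE -[RHS](line_identity xiP N1
    (fun j => - y_xi M e (nd p1 j)) (fun j => - x_xi M e (nd p1 j))
    (fun j => W e (nd p1 j)) (fun j => admW e p1 j)).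
  apply: eq_bigr => p2 _; congr (_ * (_ * _)); apply: eq_bigr => j _; congr (_ * _).
  by apply: eq_bigr => k _; congr (_ * _); rewrite /gtilde_sharp /volume_flux /avg; field.
have dotVB p1 p2 (h h' : 'I_4 -> R) :
    dotV p1 p2 (fun k => h k - h' k) = dotV p1 p2 h - dotV p1 p2 h'.
  by rewrite /dotV -sumrB; apply: eq_bigr => k _; rewrite mulrBr.
pose bx o q := dotV o q (fun k => ftilde xi M W e k o q)
  - (y_eta M e (nd o q) * psi_f (W e (nd o q)) - x_eta M e (nd o q) * psi_g (W e (nd o q))).
pose by_ o q := dotV q o (fun k => gtilde xi M W e k q o)
  - (- y_xi M e (nd q o) * psi_f (W e (nd q o)) - - x_xi M e (nd q o) * psi_g (W e (nd q o))).
have f0E q : f0 q = dotV ord0 q (fun k => ftilde xi M W e k ord0 q)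
    - dotV ord0 q (fun k => interface_flux xi M W e xi_minus k q) := dotVB _ _ _ _.
have fNE q : fN q = dotV ord_max q (fun k => ftilde xi M W e k ord_max q)
    - dotV ord_max q (fun k => interface_flux xi M W e xi_plus k q) := dotVB _ _ _ _.
have g0E q : g0 q = dotV q ord0 (fun k => gtilde xi M W e k q ord0)
    - dotV q ord0 (fun k => interface_flux xi M W e eta_minus k q) := dotVB _ _ _ _.
have gNE q : gN q = dotV q ord_max (fun k => gtilde xi M W e k q ord_max)
    - dotV q ord_max (fun k => interface_flux xi M W e eta_plus k q) := dotVB _ _ _ _.
(* The terms $\bm V\cdot\tilde{\bm f}$ from the volume and from the surface correction cancel,
   leaving the potential and the interface flux. *)
have fxE q : bx ord_max q - bx ord0 q + (f0 q - fN q) =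
    - (face_flux (e, xi_plus) q + face_flux (e, xi_minus) q).
  have pN : face_pt xi_plus (xi q) = nd ord_max q by rewrite /face_pt /node xN.
  have p0 : face_pt xi_minus (xi q) = nd ord0 q by rewrite /face_pt /node x0.
  rewrite f0E fNE !face_fluxE pN p0 /bx /dot2 /face_vec /face_sgn /= /dotV.
  ring.
have fyE q : by_ ord_max q - by_ ord0 q + (g0 q - gN q) =
    - (face_flux (e, eta_plus) q + face_flux (e, eta_minus) q).
  have pN : face_pt eta_plus (xi q) = nd q ord_max by rewrite /face_pt /node xN.
  have p0 : face_pt eta_minus (xi q) = nd q ord0 by rewrite /face_pt /node x0.
  rewrite g0E gNE !face_fluxE pN p0 /by_ /dot2 /face_vec /face_sgn /= /dotV.
  ring.
have cancel_metric : \sum_p2 w p2 * (\sum_p1 w p1 *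
      (psi_f (W e (nd p1 p2)) * (\sum_i D p1 i * y_eta M e (nd i p2))
       - psi_g (W e (nd p1 p2)) * (\sum_i D p1 i * x_eta M e (nd i p2)))) +
    \sum_p1 w p1 * (\sum_p2 w p2 *
      (psi_f (W e (nd p1 p2)) * (\sum_j D p2 j * - y_xi M e (nd p1 j))
       - psi_g (W e (nd p1 p2)) * (\sum_j D p2 j * - x_xi M e (nd p1 j)))) = 0.
  under eq_bigr => p2 _ do rewrite mulr_sumr.
  rewrite exchange_big -big_split /= big1 // => p1 _.
  rewrite mulr_sumr -big_split /= big1 // => p2 _.
  have [<- <-] := metricP e p1 p2.
  under [X in _ + _ * (_ * (_ * X - _))]eq_bigr => j _ do rewrite mulrN.
  under [X in _ + _ * (_ * (_ - _ * X))]eq_bigr => j _ do rewrite mulrN.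
  by rewrite !sumrN; ring.
have X2E' : X2 = \sum_p2 w p2 * (\sum_p1 w p1 *
      (psi_f (W e (nd p1 p2)) * (\sum_i D p1 i * y_eta M e (nd i p2))
       - psi_g (W e (nd p1 p2)) * (\sum_i D p1 i * x_eta M e (nd i p2))))
    + \sum_q w q * (bx ord_max q - bx ord0 q).
  rewrite X2E -big_split /=; apply: eq_bigr => q _; rewrite -mulrDr; congr (_ * _).
  exact: esym (addrA _ _ _).
have X3E' : X3 = \sum_p1 w p1 * (\sum_p2 w p2 *
      (psi_f (W e (nd p1 p2)) * (\sum_j D p2 j * - y_xi M e (nd p1 j))
       - psi_g (W e (nd p1 p2)) * (\sum_j D p2 j * - x_xi M e (nd p1 j))))
    + \sum_q w q * (by_ ord_max q - by_ ord0 q).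
  rewrite X3E -big_split /=; apply: eq_bigr => q _; rewrite -mulrDr; congr (_ * _).
  exact: esym (addrA _ _ _).
have XS : X2 + X3 + \sum_p w p * (g0 p - gN p) + \sum_p w p * (f0 p - fN p) =
    - (\sum_q w q * (face_flux (e, xi_plus) q + face_flux (e, xi_minus) q)
       + \sum_q w q * (face_flux (e, eta_plus) q + face_flux (e, eta_minus) q)).
  rewrite X2E' X3E' addrACA cancel_metric add0r -addrA [X in _ + X]addrC addrACA opprD.
  congr (_ + _); rewrite -big_split -sumrN; apply: eq_bigr => q _ /=.
    by rewrite -mulrDr fxE mulrN.
  by rewrite -mulrDr fyE mulrN.
rewrite -[LHS]/X1.
have -> : X1 = \sum_q w q * (face_flux (e, xi_plus) q + face_flux (e, xi_minus) q)
       + \sum_q w q * (face_flux (e, eta_plus) q + face_flux (e, eta_minus) q).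
  by apply/eqP; rewrite -subr_eq0 -XS; apply/eqP; rewrite -[RHS]balance !addrA.
rewrite sum_pair big_bool !big_bool /= addrC -!big_split /=; apply: eq_bigr => q _.
by rewrite /xi_plus /xi_minus /eta_plus /eta_minus; ring.
Qed.

End ElementBalance.

(** * Pairing the two sides of an interface *)

Section Pairing.
Context {R : realType} {N Ne : nat} {xi : 'I_N.+1 -> R} {M : mesh R Ne} {Omega : set (R * R)}.
Context {W : 'I_Ne -> R * R -> 'rV[R]_4}.
Hypothesis xiP : is_LGL xi.
Hypothesis N1 : (1 <= N)%N.
Hypothesis HM : conforming_mesh M Omega.
Hypothesis admW : forall e p1 p2, admissible (W e (node xi p1 p2)).
Local Notation w := (lgl_weight xi).
Implicit Types (F : 'I_Ne * face) (q : 'I_N.+1).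

Lemma dot2E (a b : R) (n : R * R) : dot2 (a, b) n = a * n.1 + b * n.2.
Proof. by []. Qed.

Lemma dot2N (a b : R) (n : R * R) : dot2 (a, b) (- n.1, - n.2) = - dot2 (a, b) n.
Proof. by rewrite /dot2 /= !mulrN opprD. Qed.

Lemma lf_fluxN (n : R * R) (UL UR : 'rV[R]_4) k :
  lf_flux (- n.1, - n.2) UR UL 0 k = - lf_flux n UL UR 0 k.
Proof.
have e : lf_speed (- n.1, - n.2) UR UL = lf_speed n UL UR.
  rewrite /lf_speed maxC; have dN a : `|dot2 a (- n.1, - n.2)| = `|dot2 a n|.
    by rewrite -normrN /dot2 /=; congr (`|_|); ring.
  by rewrite !dN.
by rewrite !mxE e /dot2 /=; field.
Qed.

Lemma node_in q : -1 <= xi q <= 1.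
Proof.
case: (xiP) => inc x0 xN _; rewrite -x0 -xN.
have le (i j : 'I_N.+1) : (i <= j)%N -> xi i <= xi j.
  by rewrite leq_eqVlt => /orP [/eqP/val_inj -> //|/inc /ltW].
by rewrite !le //= -ltnS ltn_ord.
Qed.

Lemma trace_admissible F q : admissible (trace_in W F (xi q)).
Proof.
case: (xiP) => _ x0 xN _; rewrite /trace_in /face_pt /face_sgn.
case: F => e [[] []] /=; rewrite -?x0 -?xN; exact: admW.
Qed.

Definition node_match F q : 'I_N.+1 :=
  if face_rev M F then node_opp q (xi := xi) else q.

Lemma node_matchE F q : xi (node_match F q) = nbr_param M F (xi q).
Proof.
by rewrite /node_match /nbr_param; case: ifP => // _; rewrite node_oppE.
Qed.

Lemma trace_out_admissible F q : admissible (trace_out M W F (xi q)).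
Proof. by rewrite /trace_out -node_matchE; exact: trace_admissible. Qed.

(** Reindexing by the involution [nbr], and by [node_opp] on reversed faces, where the symmetry of
    the weights is needed. *)
Lemma face_flux_sum : \sum_F \sum_q w q * face_flux (M := M) (W := W) (xi := xi) F q =
  \sum_F \sum_q w q * face_flux (M := M) (W := W) (xi := xi) (nbr M F) (node_match F q).
Proof.
have nbrK : involutive (nbr M) := nbr_invol HM.
rewrite (reindex_inj (inv_inj nbrK)) /=; apply: eq_bigr => F _.
rewrite /node_match; case: (face_rev M F) => //.
rewrite (reindex_inj (inv_inj (node_oppK xiP N1))) /=; apply: eq_bigr => q _.
by rewrite weight_opp.
Qed.

Lemma face_flux_pair F q :
  entropy_stable_at (outward_normal M F (xi q)) (trace_in W F (xi q)) (trace_out M W F (xi q)) ->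
  face_flux (M := M) (W := W) (xi := xi) F q
  + face_flux (M := M) (W := W) (xi := xi) (nbr M F) (node_match F q) <= 0.
Proof.
have hq := node_in q.
rewrite /entropy_stable_at (entropy_varE _ (trace_admissible F q))
  (entropy_varE _ (trace_out_admissible F q)) /face_flux node_matchE.
have -> : trace_out M W (nbr M F) (nbr_param M F (xi q)) = trace_in W F (xi q).
  by rewrite /trace_out (nbr_paramK HM) (nbr_invol HM).
rewrite -/(trace_out M W F (xi q)) -!norm2_scaled (outward_normal_nbr HM _ _ hq)
  (scaled_normal_nbr HM _ _ hq) norm2N.
have nu := norm2_unit (scaled_normal F (xi q) (M := M)).
have A1 : (scaled_normal F (xi q) (M := M)).1 =
    norm2 (scaled_normal F (xi q) (M := M)) * (outward_normal M F (xi q)).1.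
  by rewrite outward_normalE; exact: esym (congr1 fst nu).
have A2 : (scaled_normal F (xi q) (M := M)).2 =
    norm2 (scaled_normal F (xi q) (M := M)) * (outward_normal M F (xi q)).2.
  by rewrite outward_normalE; exact: esym (congr1 snd nu).
rewrite !dot2N !dot2E A1 A2; have n0 := norm2_ge0 (scaled_normal F (xi q) (M := M)).
move: (norm2 _) n0 (trace_in W F (xi q)) (trace_out M W F (xi q)) (outward_normal M F (xi q)).
move=> A A0 UL UR n.
have -> : \sum_k evar UR 0 k * lf_flux (- n.1, - n.2) UR UL 0 k =
    - \sum_k evar UR 0 k * lf_flux n UL UR 0 k.
  by rewrite -sumrN; apply: eq_bigr => k _; rewrite lf_fluxN mulrN.
have -> : \sum_(k < 4) (evar UR 0 k - evar UL 0 k) * lf_flux n UL UR 0 k =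
    \sum_k evar UR 0 k * lf_flux n UL UR 0 k - \sum_k evar UL 0 k * lf_flux n UL UR 0 k.
  by rewrite -sumrB; apply: eq_bigr => k _; rewrite mulrBl.
move: (\sum_k evar UL 0 k * _) (\sum_k evar UR 0 k * _) => SL SR h.
(* The fluxes on the two sides are opposite, so the pair is the assumed nonpositive quantity times
   the length [A] of the scaled normal, common to both sides. *)
rewrite -(mulr0 A) [leLHS](_ : _ = A * (SR - SL -
  ((psi_f UR - psi_f UL) * n.1 + (psi_g UR - psi_g UL) * n.2))); last by ring.
exact: ler_wpM2l.
Qed.

End Pairing.

Theorem theorem3p2 (R : realType) (N Ne : nat) (xi : 'I_N.+1 -> R)
    (Omega : set (R * R)) (M : mesh R Ne) (T : interval R)
    (U : 'I_Ne -> R -> R * R -> 'rV[R]_4) :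
  (1 <= N)%N ->
  is_LGL xi ->
  conforming_mesh M Omega ->
  metric_identities xi M ->
  (forall e t k, t \in T -> in_QN xi (fun z => U e t z 0 k)) ->
  (forall e t p1 p2 k, t \in T ->
     derivable (fun s : R => U e s (node xi p1 p2) 0 k) t 1) ->
  (forall e t p1 p2, t \in T -> admissible (U e t (node xi p1 p2))) ->
  (forall e t p1 p2 k, t \in T ->
     dgsem_residual xi M (fun e' => U e' t) e k p1 p2
       (derive1 (fun s : R => U e s (node xi p1 p2) 0 k) t) = 0) ->
  (forall t (F : 'I_Ne * face) (q : 'I_N.+1), t \in T ->
     entropy_stable_at (outward_normal M F (xi q))
       (trace_in (fun e => U e t) F (xi q))
       (trace_out M (fun e => U e t) F (xi q))) ->
  forall t, t \in T ->
    \sum_(e < Ne) \sum_(p1 < N.+1) \sum_(p2 < N.+1)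
      lgl_weight xi p1 * lgl_weight xi p2 * jac M e (node xi p1 p2)
      * derive1 (fun s : R => entropy (U e s (node xi p1 p2))) t <= 0.
Proof.
move=> N1 xiP HM metricP _ dU admU res stable t tT.
pose W e := U e t.
have admW e p1 p2 : admissible (W e (node xi p1 p2)) := admU e t p1 p2 tT.
pose dW e k p1 p2 : R := derive1 (fun s : R => U e s (node xi p1 p2) 0 k) t.
pose c := face_flux (M := M) (W := W) (xi := xi).
have -> : \sum_(e < Ne) \sum_(p1 < N.+1) \sum_(p2 < N.+1)
      lgl_weight xi p1 * lgl_weight xi p2 * jac M e (node xi p1 p2)
      * derive1 (fun s : R => entropy (U e s (node xi p1 p2))) t =
    \sum_(F : 'I_Ne * (bool * bool)) \sum_q lgl_weight xi q * c F q.
  rewrite sum_pair; apply: eq_bigr => e _.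
  rewrite -(element_balance xiP N1 metricP admW e (dW e)) => [|k p1 p2]; last exact: res.
  apply: eq_bigr => p1 _; apply: eq_bigr => p2 _; congr (_ * _).
  have dk k : is_derive t (1 : R) (fun s => U e s (node xi p1 p2) 0 k) (dW e k p1 p2).
    by apply: (DeriveDef (dU e t p1 p2 k tT)); rewrite /dW derive1E.
  by rewrite derive1E; apply: (derive_val (is_derive := is_derive_entropy _ _ _ dk (admW e p1 p2))).
have two : 0 < (2 : R) by [].
(* The sum is doubled so that one copy can be reindexed by [face_flux_sum] and combined with the
   other, face by face and node by node. *)
rewrite -(pmulr_rle0 _ two) mulr2n mulrDl mul1r.
rewrite {2}(face_flux_sum xiP N1 HM) -big_split /= -oppr_ge0 -sumrN.
apply: sumr_ge0 => F _; rewrite oppr_ge0 -big_split /= -oppr_ge0 -sumrN.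
apply: sumr_ge0 => q _; rewrite oppr_ge0 -mulrDr.
rewrite mulr_ge0_le0 ?(lgl_weight_ge0 xiP) //.
exact: (face_flux_pair xiP N1 HM admW F q (stable t F q tT)).
Qed.
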